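(* Assume that $(A(\cdot),B(\cdot))$ is exponentially $\theta$-periodic stabilizable and that $(A(\cdot),C(\cdot))$ is exponentially $\theta$-periodic detectable. Then there exist two positive constants $M,\mu$ such that, for every $T>0$, $$\|P_\theta(t)-P^T(t)\|\le Me^{-\mu(T-t)},\qquad 0\le t\le T,$$ where $P_\theta(\cdot)$ is the $\theta$-periodic mild solution of the differential periodic Riccati equation $$\dot P+A^*(t)P+PA(t)-PB(t)Q^{-1}(t)B^*(t)P+C^*(t)C(t)=0\ \text{ on }(0,\theta),\qquad P(\theta)=P(0)$$ (extended $\theta$-periodically), and $P^T(\cdot)$ is the mild solution of $$\dot P+A^*(t)P+PA(t)-PB(t)Q^{-1}(t)B^*(t)P+C^*(t)C(t)=0\ \text{ on }(0,T),\qquad P(T)=0.$$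
   Context: Setting. $H$ and $U$ are Hilbert spaces; $L(U,H)$ is the space of bounded linear operators from $U$ to $H$, $L(H)=L(H,H)$; $\Sigma^+(H)$ is the set of self-adjoint nonnegative $P\in L(H)$ (similarly $\Sigma^+(U)$). Continuity of operator-valued functions is understood strongly: $P\in C([a,b];L(H))$ means that $t\mapsto P(t)x$ is continuous for every $x\in H$ (and similarly for the other operator spaces). Fix a period $\theta>0$. For each $t$, $A(t)$ is a (possibly unbounded) linear operator in $H$; $B(\cdot)\in C(\mathbb{R},L(U,H))$, $C(\cdot)\in C(\mathbb{R},\Sigma^+(H))$, $Q(\cdot)\in C(\mathbb{R},\Sigma^+(U))$, and there is $\varepsilon>0$ with $Q(t)\ge\varepsilon I$ for all $t$. The functions $A,B,C,Q$ are $\theta$-periodic. $A(\cdot)$ generates an evolution system: there is a strongly continuous map $(t,s)\mapsto U_A(t,s)\in L(H)$, $t\ge s$, with $\frac{\partial}{\partial t}U_A(t,s)=A(t)U_A(t,s)$, $U_A(s,s)=I$, $U_A(t,r)U_A(r,s)=U_A(t,s)$ for $s\le r\le t$, which is $\theta$-periodic: $U_A(t+\theta,s+\theta)=U_A(t,s)$. Moreover, for $n$ large, the Yosida approximations $A_n(t)=n^2(n-A(t))^{-1}-nI$ exist for all $t\ge0$, and their evolution operators satisfy $U_{A_n}(t,s)x\to U_A(t,s)x$ as $n\to\infty$ for every $x\in H$, uniformly on $\{0\le s\le t\le\theta\}$. For a $\theta$-periodic $D(\cdot)\in C(\mathbb{R};L(H))$, the evolution operator $V$ generated by $A(\cdot)+D(\cdot)$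 is given by $V(t,s)x=U_A(t,s)x+\int_s^tU_A(t,r)D(r)V(r,s)x\,dr$. The system $\dot y=(A(t)+D(t))y$ is exponentially stable if there are $M,\rho>0$ with $\|V(t,s)\|\le Me^{-\rho(t-s)}$ for all $0\le s\le t$. $(A(\cdot),B(\cdot))$ is exponentially $\theta$-periodic stabilizable if there is a $\theta$-periodic $K_1(\cdot)\in C(\mathbb{R};L(H,U))$ such that $\dot y=(A(t)+B(t)K_1(t))y$ is exponentially stable. $(A(\cdot),C(\cdot))$ is exponentially $\theta$-periodic detectable if there is a $\theta$-periodic $K_2(\cdot)\in C(\mathbb{R};L(H))$ such that $\dot y=(A(t)+K_2(t)C(t))y$ is exponentially stable. Mild solutions of the Riccati equation. $P(\cdot)\in C([0,T];\Sigma^+(H))$ is a mild solution on $[0,T]$ with terminal value $P(T)$ if for all $t\in[0,T]$, $h\in H$: $$P(t)h=U_A(T,t)^*P(T)U_A(T,t)h-\int_t^TU_A(s,t)^*\big(P(s)B(s)Q^{-1}(s)B^*(s)P(s)-C^*(s)C(s)\big)U_A(s,t)h\,ds.$$ The same definition is used on $[0,\theta]$ with $P(\theta)=P(0)$. It is known that the terminal value problem with $P(T)=0$ has a unique mild solution $P^T\in C([0,T];\Sigma^+(H))$ and that, under the stabilizability and detectability assumptions, the periodic problem has a unique $\theta$-periodic mild solution $P_\theta\in C([0,\theta];\Sigma^+(H))$. *)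

(* Defs.v *)
From HB Require Import structures.
From mathcomp Require Import all_boot all_order all_algebra.
From mathcomp Require Import all_classical all_reals all_analysis.

Set Implicit Arguments.
Unset Strict Implicit.
Unset Printing Implicit Defensive.

Import Order.TTheory GRing.Theory Num.Theory.
Import numFieldNormedType.Exports.

Local Open Scope classical_set_scope.
Local Open Scope ring_scope.

(* Real Hilbert spaces. A complex Hilbert space becomes one by restricting the
   scalars and taking the real part of its inner product; this changes neither
   boundedness, nor operator norms, nor adjoints, nor nonnegativity, nor
   integrals. *)
HB.mixin Record CompleteNormedModule_isHilbert (R : realType) V
    & CompleteNormedModule R V := {
  dotp : {dot V for (@idfun R)} ;
  sqr_normE : forall x : V, `|x| ^+ 2 = dotp x x
}.

#[short(type="hilbertType")]
HB.structure Definition Hilbert (R : realType) :=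
  {V of CompleteNormedModule_isHilbert R V & CompleteNormedModule R V}.

HB.mixin Record isBoundedFun (R : realType) (V W : normedModType R)
    (f : V -> W) := {
  bounded_fun_normP : bounded_fun_norm f
}.

HB.structure Definition BoundedOperator (R : realType) (V W : normedModType R) :=
  {f of @GRing.Linear R V W *:%R f & @isBoundedFun R V W f}.

Notation "''L' ( V , W )" := (BoundedOperator.type V W)
  (format "''L' ( V ,  W )") : type_scope.

Section operators.
Context {R : realType}.

Definition opnorm (V W : normedModType R) (f : V -> W) : R :=
  sup [set `|f x| | x in [set x : V | `|x| <= 1]].

(* The Hilbert-space adjoint: for bounded f the Riesz representation theorem
   makes z exist, and it is unique. *)
Definition adjoint (V W : hilbertType R) (f : V -> W) (y : W) : V :=
  xget 0 [set z : V | forall x, dotp (f x) y = dotp x z].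

(* Only meaningful for a bijective f. *)
Definition inverse (V W : normedModType R) (f : V -> W) (y : W) : V :=
  xget 0 [set x : V | f x = y].

Definition nonneg_selfadjoint (V : hilbertType R) (P : V -> V) : Prop :=
  (forall x y, dotp (P x) y = dotp x (P y)) /\ (forall x, 0 <= dotp (P x) x).

Definition op_periodic (V W : normedModType R) (theta : R)
    (F : R -> 'L(V, W)) : Prop :=
  forall t x, F (t + theta) x = F t x.

Definition strongly_continuous (V W : normedModType R)
    (F : R -> 'L(V, W)) : Prop :=
  forall x, continuous (fun t => F t x).

End operators.

(* A possibly unbounded operator; the values of the function outside the domain
   are irrelevant. *)
Record partial_operator (H : Type) := PartialOperator {
  dom : set H ;
  partial_fun :> H -> H
}.

Section unbounded.
Context {R : realType} {H : normedModType R}.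

Definition linear_operator (A : partial_operator H) : Prop :=
  dom A 0 /\
  forall (a : R) x y, dom A x -> dom A y ->
    dom A (a *: x + y) /\ A (a *: x + y) = a *: A x + A y.

Definition unbounded_periodic (theta : R) (A : R -> partial_operator H) : Prop :=
  forall t, dom (A (t + theta)) = dom (A t) /\
    (forall x, dom (A t) x -> A (t + theta) x = A t x).

Definition resolvent (A : partial_operator H) (l : R) (y : H) : H :=
  xget 0 [set x | dom A x /\ l *: x - A x = y].

Definition in_resolvent_set (A : partial_operator H) (l : R) : Prop :=
  (forall y, exists! x, dom A x /\ l *: x - A x = y) /\
  bounded_fun_norm (resolvent A l).

Definition yosida (A : R -> partial_operator H) (n : nat) (t : R) :
    partial_operator H :=
  PartialOperator setT
    (fun x => n%:R ^+ 2 *: resolvent (A t) n%:R x - n%:R *: x).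

(* The evolution operators with times in J generated by A. For unbounded A(t)
   the equation d/dt U(t,s)x = A(t)U(t,s)x makes sense only for suitable x: it
   is required for x in the domain of A(s) and t > s. *)
Record evolution_system (J : set R) (A : R -> partial_operator H)
    (UA : R -> R -> 'L(H, H)) : Prop := EvolutionSystem {
  evolution_continuous : forall x,
    {within [set p : R * R | [/\ J p.1, J p.2 & p.2 <= p.1]],
      continuous (fun p => UA p.1 p.2 x)} ;
  evolution_derive : forall s t x, J s -> J t -> s < t -> dom (A s) x ->
    dom (A t) (UA t s x) /\
    is_derive t (1 : R) (fun r : R => UA r s x) (A t (UA t s x)) ;
  evolution_id : forall s x, J s -> UA s s x = x ;
  evolution_comp : forall s r t x, J s -> J r -> J t -> s <= r -> r <= t ->
    UA t r (UA r s x) = UA t s x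
}.

Definition evolution_periodic (theta : R) (UA : R -> R -> 'L(H, H)) : Prop :=
  forall t s x, s <= t -> UA (t + theta) (s + theta) x = UA t s x.

Definition yosida_convergent (theta : R) (A : R -> partial_operator H)
    (UA : R -> R -> 'L(H, H)) : Prop :=
  exists2 UAn : nat -> R -> R -> 'L(H, H),
    (\forall n \near \oo,
      (forall t, 0 <= t -> in_resolvent_set (A t) n%:R) /\
      evolution_system [set t | 0 <= t] (yosida A n) (UAn n)) &
    forall x (e : R), 0 < e -> \forall n \near \oo,
      forall s t, 0 <= s -> s <= t -> t <= theta ->
        `|UAn n t s x - UA t s x| < e.

End unbounded.

Section riccati.
Context {R : realType} {H U : hilbertType R}.

(* v is the integral of f over [a, b] in the weak (Pettis) sense, which agrees
   with the Bochner integral whenever the latter exists. The integrand of the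
   mild Riccati equation need not be Riemann integrable, because adjoints of
   strongly continuous families are in general only weakly continuous. *)
Definition is_integral (f : R -> H) (a b : R) (v : H) : Prop :=
  forall y,
    lebesgue_measure.-integrable `[a, b] (fun s => (dotp (f s) y)%:E) /\
    dotp v y = \int[lebesgue_measure]_(s in `[a, b]) dotp (f s) y.

(* V is the evolution operator generated by A + D, where A generates UA. *)
Definition perturbed_evolution (UA : R -> R -> 'L(H, H)) (D : R -> H -> H)
    (V : R -> R -> 'L(H, H)) : Prop :=
  (forall x, {within [set p : R * R | p.2 <= p.1],
     continuous (fun p => V p.1 p.2 x)}) /\
  (forall t s x, s <= t ->
     exists2 I, is_integral (fun r => UA t r (D r (V r s x))) s t I &
       V t s x = UA t s x + I).

Definition exponentially_stable (UA : R -> R -> 'L(H, H)) (D : R -> H -> H) :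
    Prop :=
  exists2 V, perturbed_evolution UA D V &
  exists M rho : R, [/\ 0 < M, 0 < rho &
    forall s t, 0 <= s -> s <= t ->
      opnorm (V t s) <= M * expR (- rho * (t - s))].

Definition stabilizable (theta : R) (UA : R -> R -> 'L(H, H))
    (B : R -> 'L(U, H)) : Prop :=
  exists K1 : R -> 'L(H, U), [/\ op_periodic theta K1, strongly_continuous K1 &
    exponentially_stable UA (fun t x => B t (K1 t x))].

Definition detectable (theta : R) (UA : R -> R -> 'L(H, H))
    (C : R -> 'L(H, H)) : Prop :=
  exists K2 : R -> 'L(H, H), [/\ op_periodic theta K2, strongly_continuous K2 &
    exponentially_stable UA (fun t x => K2 t (C t x))].

(* Mild solution of the Riccati equation on [0, T] with terminal value P(T). *)
Definition mild_solution (UA : R -> R -> 'L(H, H)) (B : R -> 'L(U, H))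
    (C : R -> 'L(H, H)) (Q : R -> 'L(U, U)) (T : R) (P : R -> 'L(H, H)) :
    Prop :=
  [/\ forall t, 0 <= t <= T -> nonneg_selfadjoint (P t),
      forall x, {within `[0, T], continuous (fun t => P t x)} &
      forall t h, 0 <= t <= T ->
        exists2 I,
          is_integral (fun s =>
            adjoint (UA s t)
              (P s (B s (inverse (Q s) (adjoint (B s) (P s (UA s t h)))))
               - adjoint (C s) (C s (UA s t h)))) t T I &
          P t h = adjoint (UA T t) (P T (UA T t h)) - I].

End riccati.

(* Main.v *)
Require Import Defs.
From HB Require Import structures.
From mathcomp Require Import all_boot all_order all_algebra.
From mathcomp Require Import all_classical all_reals all_analysis.
From mathcomp Require Import measurable_realfun ring lra.

Set Implicit Arguments.
Unset Strict Implicit.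
Unset Printing Implicit Defensive.

Import Order.TTheory GRing.Theory Num.Theory.
Import numFieldNormedType.Exports.

Local Open Scope classical_set_scope.
Local Open Scope ring_scope.

(** The difference D = P_theta - P^T of the two Riccati solutions satisfies, along
every trajectory y driven by a control, a balance of energies in which the
observation term |C y|^2 cancels. Along the closed loop
y' = (A - B Q^-1 B^* P^T) y the form (D y, y) does not decrease, whence
(D(t)x, x) <= (P_theta(T) y(T), y(T)) because P^T(T) = 0; along the closed loop
of P_theta it does not increase, whence D(t) >= 0. As D(t) is self-adjoint, what remains
is the exponential decay of y(T), at a rate that depends on T - t only.

Decay is where detectability enters. On a window of length at most L, with the
energy W(t) = (P^T(t) y(t), y(t)) and the observer z' = (A + K C) z started at
the same point, the gap y - z is driven by B u and K C y, so its square is at most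
a constant times the integral of |C y|^2 + (Q u, u), which is the drop of W over
the window. As z is exponentially stable, a long window gives
|y(t + l)|^2 <= 1/2 |x|^2 + w (W(t) - W(t + l)); hence |y|^2 + w W, which is at
most (1 + w p) |y|^2 because 0 <= P^T <= P_theta <= p, is multiplied over each
window by a factor smaller than 1.

The coefficients are only strongly continuous, so B^* and the adjoint of U_A are
only weakly continuous in time, and B Q^-1 B^* need not be continuous even in the
weak sense. Two devices deal with that.

- Scalar functions such as (Q^-1 B^* p1, B^* p2) are Lebesgue measurable: the
quadratic form of Q^-1 is a supremum of continuous functions
2 (v, w) - (Q v, v), and polarization gives the rest
([measurable_inverse]). Vectors defined by an integral are obtained from Riesz's
theorem.

- No closed-loop equation is solved and nothing is differentiated. One
step from s to t replaces y by U_A(t,s) y plus the effect of the feedback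
evaluated along U_A(r,s) y ([is_step]). The balance of energy over one step holds
up to O((t - s)^2) ([energy_step]), because the mild Riccati equation can be
restarted at every time ([riccati_on]). With n steps the errors sum to O(1/n)
([compare_chain], [dissipation_chain]), and n tends to infinity in the final
inequalities. Sums over steps are controlled by discrete versions of
Duhamel's formula and of Gronwall's lemma ([discrete_duhamel],
[discrete_gronwall]), for the trajectory as well as for its gap to the
observer ([gap_bound]). *)

(** * Elementary inequalities *)

Section inequalities.
Context {R : realType}.

Lemma psd_discriminant (a b c : R) : 0 <= a -> 0 <= c ->
  (forall t, 0 <= a + t * b *+ 2 + t ^+ 2 * c) -> b ^+ 2 <= a * c.
Proof.
move=> a0 c0 h; have [c00|c_neq0] := eqVneq c 0.
  suff -> : b = 0 by rewrite expr0n /= mulr_ge0.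
  apply/eqP/negPn/negP => b0; have := h (- (a + 1) / (b *+ 2)).
  rewrite c00 mulr0 addr0 -mulrnAr mulrVK ?unitfE ?mulrn_eq0 //.
  by lra.
have cp : 0 < c by rewrite lt_def c_neq0.
have := h (- b / c).
have -> : a + - b / c * b *+ 2 + (- b / c) ^+ 2 * c = (a * c - b ^+ 2) / c.
  by field.
by rewrite pmulr_lge0 ?invr_gt0 // subr_ge0.
Qed.

Lemma young (u l : R) : 0 <= u -> 0 < l -> u <= l + u ^+ 2 / l.
Proof.
move=> u_ge0 l_gt0; have : 0 <= (u - l) ^+ 2 / l by rewrite divr_ge0 ?sqr_ge0 // ltW.
have -> : (u - l) ^+ 2 / l = u ^+ 2 / l + l - u *+ 2 by field; rewrite gt_eqF.
lra.
Qed.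

(** Optimization of the free weight l of Young's inequality. *)
Lemma gap_sqr (d G L E e : R) : 0 <= d -> 0 < G -> 0 < L -> 0 <= E -> 0 <= e ->
  (forall l, 0 < l -> d <= G * (l * L + E / l) + e) ->
  d ^+ 2 <= 8 * G ^+ 2 * L * E + 2 * e ^+ 2.
Proof.
move=> d_ge0 G_gt0 L_gt0 E_ge0 e_ge0 h.
have GLE : 0 <= G ^+ 2 * L * E by rewrite !mulr_ge0 // ltW.
case: (leP d e) => de.
  have d2 : d ^+ 2 <= e ^+ 2 by apply: lerXn2r.
  have e2 : 0 <= e ^+ 2 by rewrite sqr_ge0.
  have -> : 8 * G ^+ 2 * L * E = 8 * (G ^+ 2 * L * E) by ring.
  move: (d ^+ 2) (e ^+ 2) (G ^+ 2 * L * E) d2 e2 GLE => *; lra.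
have u_gt0 : 0 < d - e by rewrite subr_gt0.
have [u dE] : exists u : R, d = u + e by exists (d - e); rewrite subrK.
rewrite dE addrK in u_gt0.
(* this weight makes G * (l * L) equal to u / 2, which is then absorbed *)
have := h (u / (2 * G * L)) ltac:(by rewrite divr_gt0 ?mulr_gt0).
have -> : G * (u / (2 * G * L) * L + E / (u / (2 * G * L))) + e =
    u / 2 + 2 * (G ^+ 2 * L * E) / u + e by field; rewrite !gt_eqF.
rewrite dE lerD2r => hu.
have {}hu : u ^+ 2 <= 4 * (G ^+ 2 * L * E).
  have hv (v : R) : u <= u / 2 + v -> u <= 2 * v by move=> ?; lra.
  have := hv _ hu; rewrite mulrA ler_pdivlMr // => /le_trans; apply.
  by rewrite le_eqVlt; apply/orP; left; apply/eqP; ring.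
have := sqr_ge0 (u - e).
have -> : 8 * G ^+ 2 * L * E = 8 * (G ^+ 2 * L * E) by ring.
have -> : (u + e) ^+ 2 = 2 * u ^+ 2 + 2 * e ^+ 2 - (u - e) ^+ 2 by ring.
move: (u ^+ 2) (e ^+ 2) ((u - e) ^+ 2) (G ^+ 2 * L * E) hu => *; lra.
Qed.

Lemma small_harmonic (K e : R) : 0 < e -> exists2 n, (0 < n)%N & K / n%:R <= e.
Proof.
move=> e_gt0; have K1 : 0 < `|K| + 1 by rewrite ltr_wpDl.
have [N _ hN] : \forall n \near \oo, n.+1%:R^-1 < e / (`|K| + 1).
  by apply: near_infty_natSinv_lt (PosNum _); rewrite divr_gt0.
exists N.+1 => //; apply: (@le_trans _ _ ((`|K| + 1) / N.+1%:R)).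
  by rewrite ler_wpM2r ?invr_ge0 // ler_wpDr // ler_norm.
by have := ltW (hN N (leqnn N)); rewrite /= ler_pdivlMr // mulrC.
Qed.

Lemma le_of_harmonic (u v K : R) :
  (forall n, (0 < n)%N -> u <= v + K / n%:R) -> u <= v.
Proof.
move=> h; apply/ler_addgt0Pr => e e_gt0.
have [n n0 hn] := small_harmonic K e_gt0.
by apply: le_trans (h n n0) _; rewrite lerD2l.
Qed.

Lemma discrete_gronwall (a : nat -> R) (A d : R) (n : nat) : 0 <= d ->
  (forall k, (k <= n)%N -> a k <= A + d * \sum_(i < k) a i) ->
  forall k, (k <= n)%N -> a k <= A * (1 + d) ^+ k.
Proof.
move=> d_ge0 h.
have key k : (k <= n)%N -> A + d * \sum_(i < k) a i <= A * (1 + d) ^+ k.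
  elim: k => [|k IH] kn; first by rewrite big_ord0 mulr0 addr0 expr0 mulr1.
  have {}IH := IH (ltnW kn); have ak := h _ (ltnW kn).
  rewrite big_ord_recr /= mulrDr addrA exprSr mulrA mulrDr mulr1 lerD //.
  by rewrite [leRHS]mulrC ler_wpM2l // (le_trans ak).
by move=> k kn; apply: le_trans (h k kn) (key k kn).
Qed.

Lemma expr_le_expR (d : R) (n : nat) : 0 <= d -> (1 + d) ^+ n <= expR (d *+ n).
Proof.
move=> d_ge0; rewrite -mulr_natl expRM_natl; apply: lerXn2r; rewrite ?nnegrE ?expR_ge0 ?addr_ge0 //.
exact: expR_ge1Dx.
Qed.

End inequalities.

(** * Hilbert spaces: Riesz, Lax-Milgram and adjoints *)

Section hilbert.
Context {R : realType}.
Implicit Types V W : hilbertType R.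

(** The inner product, with a type in which the module structures of V are
folded, so that rewriting recognizes sums and differences. *)
Definition ip V (x y : V) : R := dotp x y.

Lemma nsa_sym V (P : V -> V) x y : nonneg_selfadjoint P -> ip (P x) y = ip x (P y).
Proof. by case=> + _; exact. Qed.

Lemma nsa_ge0 V (P : V -> V) x : nonneg_selfadjoint P -> 0 <= ip (P x) x.
Proof. by case=> _; exact. Qed.

Lemma ipC V (x y : V) : ip x y = ip y x.
Proof. by rewrite /ip (hermC dotp) /= expr0 mul1r. Qed.

Lemma ipDl V (x y z : V) : ip (x + y) z = ip x z + ip y z.
Proof. exact: linearDl. Qed.

Lemma ipBl V (x y z : V) : ip (x - y) z = ip x z - ip y z.
Proof. exact: linearBl. Qed.

Lemma ipZl V a (x z : V) : ip (a *: x) z = a * ip x z.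
Proof. exact: linearZl_LR. Qed.

Lemma ip0l V (z : V) : ip 0 z = 0.
Proof. exact: linear0l. Qed.

Lemma ipDr V (x y z : V) : ip z (x + y) = ip z x + ip z y.
Proof. by rewrite ipC ipDl !(ipC z). Qed.

Lemma ipBr V (x y z : V) : ip z (x - y) = ip z x - ip z y.
Proof. by rewrite ipC ipBl !(ipC z). Qed.

Lemma ipZr V a (x z : V) : ip z (a *: x) = a * ip z x.
Proof. by rewrite ipC ipZl (ipC z). Qed.

Lemma ipp V (x : V) : ip x x = `|x| ^+ 2.
Proof. by rewrite /ip sqr_normE. Qed.

Lemma ip_ext V (x y : V) : (forall z, ip x z = ip y z) -> x = y.
Proof.
move=> e; apply/eqP; rewrite -subr_eq0 -normr_eq0 -sqrf_eq0 -ipp.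
by rewrite ipBl e subrr.
Qed.

Lemma psd_cauchy_schwarz V (P : {linear V -> V}) (x y : V) :
  nonneg_selfadjoint P -> ip (P x) y ^+ 2 <= ip (P x) x * ip (P y) y.
Proof.
move=> Pn; apply: psd_discriminant; rewrite ?nsa_ge0 // => t.
have := nsa_ge0 (x + t *: y) Pn.
rewrite linearD linearZ /= !(ipDl, ipDr, ipZl, ipZr).
rewrite (_ : ip (P y) x = ip (P x) y); last by rewrite nsa_sym // ipC.
by move=> h; apply: le_trans h _; rewrite le_eqVlt; apply/orP; left; apply/eqP; ring.
Qed.

Lemma ip_le V (x y : V) : `|ip x y| <= `|x| * `|y|.
Proof.
rewrite -(@ler_pXn2r _ 2) ?nnegrE ?mulr_ge0 // exprMn -!ipp real_normK ?num_real //.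
have := @psd_cauchy_schwarz V idfun x y; apply.
by split => // z; rewrite -/(ip _ _) ipp exprn_ge0.
Qed.

Lemma ip_ub V (x y : V) (a b : R) : `|x| <= a -> `|y| <= b -> `|ip x y| <= a * b.
Proof. by move=> xa yb; apply: le_trans (ip_le _ _) _; rewrite ler_pM. Qed.

(** Norms of vectors that are known through their inner products only, such as
weak integrals, are bounded by duality. *)
Lemma norm_le_ip V (x : V) (c : R) : 0 <= c ->
  (forall z, `|ip x z| <= c * `|z|) -> `|x| <= c.
Proof.
move=> c0 /(_ x); rewrite ipp ger0_norm ?exprn_ge0 // expr2.
have [->|x0] := eqVneq x 0; first by rewrite normr0.
by rewrite ler_pM2r // normr_gt0.
Qed.

Lemma linfun_bounded (V W : normedModType R) (f : 'L(V, W)) :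
  exists2 M : R, 0 <= M & forall x, `|f x| <= M * `|x|.
Proof.
have [M hM] := @bounded_fun_normP _ _ _ f 1.
have M0 : 0 <= M by apply: le_trans (hM 0 _); rewrite ?normr0.
exists M => // x; have [->|x0] := eqVneq x 0.
  by rewrite linear0 !normr0 mulr0.
have nx : 0 < `|x| by rewrite normr_gt0.
have := hM (`|x|^-1 *: x).
rewrite linearZ /= !normrZ normfV normr_id mulVf ?gt_eqF // => /(_ (lexx _)).
by rewrite mulrC ler_pdivrMr.
Qed.

Lemma opnormP (V W : normedModType R) (f : V -> W) (M : R) : 0 <= M ->
  (forall x, `|f x| <= M * `|x|) -> opnorm f <= M.
Proof.
move=> M0 hM; apply: ge_sup; first by exists `|f 0|, 0 => //=; rewrite normr0.
by move=> _ [x /= x1 <-]; apply: le_trans (hM x) _; rewrite ler_piMr.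
Qed.

Lemma le_opnorm (V W : normedModType R) (f : 'L(V, W)) x : `|f x| <= opnorm f * `|x|.
Proof.
have [M M0 hM] := linfun_bounded f.
have [->|x0] := eqVneq x 0; first by rewrite linear0 !normr0 mulr0.
have nx : 0 < `|x| by rewrite normr_gt0.
rewrite -ler_pdivrMr //; apply: ub_le_sup.
  exists M => _ [y /= y1 <-]; apply: le_trans (hM y) _; by rewrite ler_piMr.
exists (`|x|^-1 *: x); last by rewrite linearZ /= normrZ normfV normr_id mulrC.
by rewrite /= normrZ normfV normr_id mulVf // gt_eqF.
Qed.

(** For symmetric Q the solution is the minimizer of (Q u, u) - 2 phi u:
a minimizing sequence is Cauchy by the parallelogram identity, and at the limit
the first variation vanishes. Riesz's theorem is the case Q = id. *)
Lemma lax_milgram V (Q : {linear V -> V}) (K eps : R) (phi : V -> R) (c : R) :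
  0 <= K -> (forall x, `|Q x| <= K * `|x|) -> 0 < eps -> (forall x y, ip (Q x) y = ip x (Q y)) ->
  (forall x, eps * ip x x <= ip (Q x) x) ->
  (forall a x y, phi (a *: x + y) = a * phi x + phi y) ->
  (forall x, `|phi x| <= c * `|x|) ->
  exists u, forall v, ip (Q u) v = phi v.
Proof.
move=> K0 hK eps0 Qsym Qcoer phil phib.
have phi0 : phi 0 = 0 by have := phil 1 0 0; rewrite scaler0 addr0; lra.
have phiZ a x : phi (a *: x) = a * phi x by rewrite -[a *: x]addr0 phil phi0 addr0.
have phiD x y : phi (x + y) = phi x + phi y by rewrite -[x in LHS]scale1r phil mul1r.
pose J u : R := ip (Q u) u - phi u *+ 2.
have JE u v t : J (u + t *: v) = J u + t * (ip (Q u) v - phi v) *+ 2 + t ^+ 2 * ip (Q v) v.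
  rewrite /J linearD linearZ /= !(ipDl, ipDr, ipZl, ipZr) phiD phiZ.
  rewrite (_ : ip (Q v) u = ip (Q u) v); last by rewrite Qsym ipC.
  by ring.
pose S := range J.
have S0 : S !=set0 by exists (J 0), 0.
have Slb u : - (c ^+ 2 / eps) <= J u.
  rewrite /J; have := Qcoer u; rewrite ipp; have := phib u.
  have := ler_norm (phi u) => h1 h2 h3.
  have : 0 <= (eps * `|u| - c) ^+ 2 / eps by rewrite divr_ge0 ?sqr_ge0 // ltW.
  have -> : (eps * `|u| - c) ^+ 2 / eps = eps * `|u| ^+ 2 - (c * `|u|) *+ 2 + c ^+ 2 / eps.
    by field; rewrite gt_eqF.
  lra.
have hS : has_inf S by split => //; exists (- (c ^+ 2 / eps)) => _ [u _ <-].
set m : R := inf S.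
have mJ u : m <= J u by apply: ge_inf; [case: hS | exists u].
have /choice [u hu] (n : nat) : exists u, J u < m + n.+1%:R^-1.
  have [_ [u _ <-] h] := @inf_adherent _ S n.+1%:R^-1 (ltac:(by rewrite invr_gt0)) hS.
  by exists u.
(* the midpoint of a and b competes with the infimum *)
have key a b (ea eb : R) : J a < m + ea -> J b < m + eb -> eps * `|a - b| ^+ 2 <= (ea + eb) *+ 2.
  move=> Ja Jb; have := mJ (a + 2^-1 *: (b - a)); rewrite JE.
  have : J b = J (a + 1 *: (b - a)) by rewrite scale1r addrC subrK.
  rewrite JE -normrN opprB -ipp; have := Qcoer (b - a).
  move: (ip (Q a) (b - a) - phi (b - a)) (ip (Q (b - a)) (b - a)) (ip (b - a) (b - a)) => A B C.
  rewrite mul1r expr1n mul1r (_ : 2^-1 ^+ 2 = 4^-1 :> R); last by field.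
  clear hu u; move: (J a) (J b) m Ja Jb {mJ} => ja jb m Ja Jb; lra.
have cu : cvg (u @ \oo).
  apply/cauchy_cvgP/cauchy_exP => e e0.
  have [N _ hN] : \forall n \near \oo, n.+1%:R^-1 < eps * e ^+ 2 / 4.
    by apply: near_infty_natSinv_lt (PosNum _); rewrite !mulr_gt0 ?exprn_gt0 ?invr_gt0.
  exists (u N); exists N => // n /= Nn.
  rewrite /ball_ -ball_normE /ball_ /=.
  rewrite -(@ltr_pXn2r _ 2) ?nnegrE ?(ltW e0) //.
  have h1 := hN n Nn; have h2 := hN N (leqnn N).
  have h3 := key _ _ _ _ (hu N) (hu n).
  rewrite -(ltr_pM2l eps0); apply: le_lt_trans h3 _.
  rewrite /= in h1 h2; move: (eps * _) h1 h2 => E.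
  move: (n.+1%:R^-1) (N.+1%:R^-1) => i j h1 h2; lra.
pose l := lim (u @ \oo).
have Jl : J l <= m.
  apply/ler_addgt0Pl => e e0; rewrite addrC.
  pose F (n : nat) : R := m + n.+1%:R^-1
    + (K * `|l - u n| + `|c|) * `|l - u n| *+ 2 + K * (`|u n| *+ 2) * `|l - u n|.
  have cF : F @ \oo --> m + 0 + (K * `|l - l| + `|c|) * `|l - l| *+ 2 + K * (`|l| *+ 2) * `|l - l|.
    have cl : u n @[n --> \oo] --> l by [].
    have cn : `|u n| @[n --> \oo] --> `|l| by apply: cvg_norm.
    have cd : `|l - u n| @[n --> \oo] --> `|l - l| by apply: cvg_norm; apply: cvgB => //; apply: cvg_cst.
    apply: cvgD; last first.
      apply: cvgM => //; apply: cvgM; first exact: cvg_cst.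
      exact: cvgMn.
    apply: cvgD; last first.
      apply: cvgMn; apply: cvgM => //; apply: cvgD; last exact: cvg_cst.
      apply: cvgM => //; exact: cvg_cst.
    apply: cvgD; first exact: cvg_cst.
    exact: cvg_harmonic.
  rewrite subrr normr0 !mulr0 mul0rn !addr0 in cF.
  suff h n : J l <= F n.
    have [N _ /(_ N (leqnn N)) /= /ltW] : \forall n \near \oo, F n < m + e.
      by apply: (cvgr_lt _ cF); rewrite ltrDl.
    exact: le_trans (h _).
  have -> : J l = J (u n + 1 *: (l - u n)) by rewrite scale1r addrC subrK.
  rewrite JE mul1r expr1n mul1r /F.
  have : `|ip (Q (u n)) (l - u n)| <= K * `|u n| * `|l - u n| by apply: ip_ub.
  have : `|ip (Q (l - u n)) (l - u n)| <= K * `|l - u n| * `|l - u n| by apply: ip_ub.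
  have : `|phi (l - u n)| <= `|c| * `|l - u n|.
    by apply: le_trans (phib _) _; rewrite ler_wpM2r // ler_norm.
  have := ltW (hu n).
  move: (J (u n)) (ip _ _) (ip _ _) (phi _) => j A B D.
  rewrite !ler_norml => h1 /andP[h2 h2'] /andP[h3 h3'] /andP[h4 h4'].
  have h5 : 0 <= K * `|l - u n| * `|l - u n| by rewrite !mulr_ge0.
  move: (n.+1%:R^-1) `|l - u n| `|u n| `|c| h1 h2 h2' h3 h3' h4 h4' h5 => *; lra.
exists l => v; apply/eqP; rewrite -subr_eq0 -sqrf_eq0 eq_le sqr_ge0 andbT.
have := @psd_discriminant R 0 (ip (Q l) v - phi v) (ip (Q v) v).
rewrite mul0r; apply => //.
  by apply: le_trans (Qcoer v); rewrite ipp mulr_ge0 ?exprn_ge0 // ltW.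
move=> t; have := mJ (l + t *: v); rewrite JE; lra.
Qed.

Lemma riesz V (phi : V -> R) (c : R) :
  (forall a x y, phi (a *: x + y) = a * phi x + phi y) ->
  (forall x, `|phi x| <= c * `|x|) ->
  exists u, forall v, ip u v = phi v.
Proof.
move=> phil phib; apply: (@lax_milgram V idfun 1 1 phi c) => // x.
- by rewrite mul1r.
- by rewrite mul1r.
Qed.

Lemma adjointP V W (f : 'L(V, W)) x y : ip (f x) y = ip x (adjoint f y).
Proof.
have [M M0 hM] := linfun_bounded f.
have [z hz] : exists z, forall v, ip z v = ip (f v) y.
  apply: (@riesz V _ (M * `|y|)) => [a u v|v].
    by rewrite linearP ipDl ipZl.
  by rewrite mulrAC; exact: ip_ub.
have : [set z : V | forall x, dotp (f x) y = dotp x z] (adjoint f y).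
  by apply: xgetPex; exists z => v; rewrite /= -!/(ip _ _) -hz ipC.
exact.
Qed.

Lemma adjoint_le V W (f : 'L(V, W)) (M : R) y : 0 <= M ->
  (forall x, `|f x| <= M * `|x|) -> `|adjoint f y| <= M * `|y|.
Proof.
move=> M0 hM; apply: norm_le_ip => [|z]; first by rewrite mulr_ge0.
by rewrite ipC -adjointP mulrAC; exact: ip_ub.
Qed.

Definition coercive (eps : R) V (Q : V -> V) :=
  nonneg_selfadjoint Q /\ forall u, eps * ip u u <= ip (Q u) u.

Lemma inverseK V (Q : 'L(V, V)) (eps : R) w : 0 < eps -> coercive eps Q ->
  Q (inverse Q w) = w.
Proof.
move=> eps0 [Qn Qc]; have [M M0 hM] := linfun_bounded Q.
have [u hu] : exists u, forall v, ip (Q u) v = ip w v.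
  apply: (@lax_milgram V Q M eps _ `|w|) => // [x y|a x y|x].
  - exact: nsa_sym.
  - by rewrite ipDr ipZr.
  - exact: ip_le.
have : [set x : V | Q x = w] (inverse Q w).
  by apply: xgetPex; exists u; exact: ip_ext.
exact.
Qed.

End hilbert.

(** * The operator B Q^-1 B^* *)

Section control_form.
Context {R : realType} {H U : hilbertType R}.

Definition feedback (B : 'L(U, H)) (Q : 'L(U, U)) (x : H) : H :=
  B (inverse Q (adjoint B x)).

Context (eps : R) (eps_gt0 : 0 < eps).

Lemma inverse_sym (Q : 'L(U, U)) w1 w2 : coercive eps Q ->
  ip (inverse Q w1) w2 = ip w1 (inverse Q w2).
Proof.
move=> Qc; rewrite -{1}(inverseK w2 eps_gt0 Qc) -[in RHS](inverseK w1 eps_gt0 Qc).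
by have [Qn _] := Qc; rewrite -(nsa_sym _ _ Qn).
Qed.

Lemma inverse_le (Q : 'L(U, U)) w : coercive eps Q ->
  eps * `|inverse Q w| ^+ 2 <= ip (inverse Q w) w.
Proof.
move=> Qc; have [_ /(_ (inverse Q w))] := Qc.
by rewrite ipp (inverseK w eps_gt0 Qc) ipC.
Qed.

Lemma norm_inverse_le (Q : 'L(U, U)) w : coercive eps Q ->
  `|inverse Q w| <= eps^-1 * `|w|.
Proof.
move=> Qc; have := inverse_le w Qc; have := ip_le (inverse Q w) w.
have [->|x0] := eqVneq (inverse Q w) 0.
  by rewrite normr0 => _ _; rewrite mulr_ge0 ?invr_ge0 // ltW.
move=> h1 h2; have nx : 0 < `|inverse Q w| by rewrite normr_gt0.
rewrite mulrC ler_pdivlMr // -(ler_pM2l nx).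
apply: le_trans (le_trans (ler_norm _) h1).
by apply: le_trans h2; rewrite le_eqVlt; apply/orP; left; apply/eqP; ring.
Qed.

(** With equality at v = Q^-1 w, this writes the quadratic form of Q^-1 as a
supremum of functions that depend continuously on w and Q. *)
Lemma inverse_sup (Q : 'L(U, U)) w v : coercive eps Q ->
  ip v w *+ 2 - ip (Q v) v <= ip (inverse Q w) w.
Proof.
move=> Qc; set u := inverse Q w; have Qu : Q u = w := inverseK w eps_gt0 Qc.
have [Qn _] := Qc; have := nsa_ge0 (u - v) Qn.
rewrite -{1 2}Qu linearB !(ipBl, ipBr) -(nsa_sym v u Qn) (nsa_sym u v Qn) (ipC u (Q v)).
by rewrite (ipC u (Q u)) => h; rewrite -subr_ge0; apply: le_trans h _;
   rewrite le_eqVlt; apply/orP; left; apply/eqP; ring.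
Qed.

Context (B : 'L(U, H)) (Q : 'L(U, U)) (Qc : coercive eps Q).

Lemma feedbackE x y :
  ip (feedback B Q x) y = ip (inverse Q (adjoint B x)) (adjoint B y).
Proof. exact: adjointP. Qed.

Lemma feedback_sym x y : ip (feedback B Q x) y = ip x (feedback B Q y).
Proof. by rewrite [RHS]ipC !feedbackE inverse_sym // ipC. Qed.

Lemma feedbackD x y : feedback B Q (x + y) = feedback B Q x + feedback B Q y.
Proof. by apply: ip_ext => z; rewrite ipDl !feedback_sym ipDl. Qed.

Lemma feedbackZ a x : feedback B Q (a *: x) = a *: feedback B Q x.
Proof. by apply: ip_ext => z; rewrite ipZl !feedback_sym ipZl. Qed.

Lemma feedbackB x y : feedback B Q (x - y) = feedback B Q x - feedback B Q y.
Proof. by rewrite -scaleN1r feedbackD feedbackZ scaleN1r. Qed.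

Lemma feedback_ge0 x : 0 <= ip (feedback B Q x) x.
Proof.
rewrite feedbackE; apply: le_trans (inverse_le _ Qc).
by rewrite mulr_ge0 ?exprn_ge0 // ltW.
Qed.

Context (b : R) (b_ge0 : 0 <= b) (Bb : forall u, `|B u| <= b * `|u|).

Lemma norm_feedback x : `|feedback B Q x| <= b ^+ 2 / eps * `|x|.
Proof.
apply: le_trans (Bb _) _.
have -> : b ^+ 2 / eps * `|x| = b * (eps^-1 * (b * `|x|)) by ring.
apply: ler_wpM2l => //; apply: le_trans (norm_inverse_le _ Qc) _.
by apply: ler_wpM2l; [rewrite invr_ge0 ltW | exact: adjoint_le].
Qed.

(** The feedback is controlled by its own cost: the bound is linear in the
quadratic form and hence can be integrated against the energy balance. *)
Lemma norm_feedback_young x (l : R) : 0 < l ->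
  `|feedback B Q x| <= b * (l + ip (feedback B Q x) x / (l * eps)).
Proof.
move=> l0; apply: le_trans (Bb _) _; apply: ler_wpM2l => //.
rewrite feedbackE; have := inverse_le (adjoint B x) Qc.
set u := inverse _ _; move: (ip u _) => q h.
have h2 : `|u| ^+ 2 / l <= q / (l * eps).
  rewrite invfM mulrA ler_pdivlMr // mulrAC [X in X / _]mulrC.
  by rewrite ler_wpM2r // invr_ge0 ltW.
by apply: le_trans (lerD (lexx _) h2); exact: young.
Qed.

End control_form.

(** * Integrals of scalar functions over segments *)

Section integral.
Context {R : realType}.
Implicit Types (a b c : R) (f g : R -> R).

Definition integrable_on a b f :=
  (@lebesgue_measure R).-integrable `[a, b] (EFin \o f).

Definition itg a b f : R := \int[@lebesgue_measure R]_(x in `[a, b]) f x.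

Lemma eq_itg a b f g : (forall r, a <= r <= b -> f r = g r) ->
  itg a b f = itg a b g.
Proof. by move=> e; apply: eq_Rintegral => r /[!inE]/=; rewrite in_itv; exact: e. Qed.

Lemma eq_integrable_on a b f g : (forall r, a <= r <= b -> f r = g r) ->
  integrable_on a b f -> integrable_on a b g.
Proof.
move=> e; apply: eq_integrable => // r /[!inE]/=; rewrite in_itv => h.
by rewrite e.
Qed.

Lemma integrable_onD a b f g : integrable_on a b f -> integrable_on a b g ->
  integrable_on a b (fun r => f r + g r).
Proof. by move=> fi gi; rewrite /integrable_on; apply: (integrableD _ fi gi). Qed.

Lemma integrable_onZ a b f c : integrable_on a b f ->
  integrable_on a b (fun r => c * f r).
Proof. by move=> fi; rewrite /integrable_on; apply: (integrableZl _ c fi). Qed.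

Lemma integrable_onB a b f g : integrable_on a b f -> integrable_on a b g ->
  integrable_on a b (fun r => f r - g r).
Proof. by move=> fi gi; rewrite /integrable_on; apply: (integrableB _ fi gi). Qed.

Lemma integrable_onS a b f c d : a <= c -> d <= b ->
  integrable_on a b f -> integrable_on c d f.
Proof.
move=> ac db; apply: integrableS => //; apply: subset_itv; rewrite bnd_simp //.
Qed.

Lemma integrable_on_bounded a b f c : measurable_fun `[a, b] f ->
  (forall r, a <= r <= b -> `|f r| <= c) -> integrable_on a b f.
Proof.
move=> mf bf; apply: measurable_bounded_integrable => //.
  by rewrite /= lebesgue_measure_itv /=; case: ifP => // _; rewrite -EFinB ltry.
exists c; split; rewrite ?num_real // => x cx r /= /[!in_itv] /= h.
exact: le_trans (bf r h) (ltW cx).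
Qed.

Lemma integrable_on_cst a b c : integrable_on a b (fun=> c).
Proof. by apply: (@integrable_on_bounded _ _ _ `|c|) => //; exact: measurable_cst. Qed.

Lemma itgD a b f g : integrable_on a b f -> integrable_on a b g ->
  itg a b (fun r => f r + g r) = itg a b f + itg a b g.
Proof. by move=> fi gi; exact: RintegralD. Qed.

Lemma itgB a b f g : integrable_on a b f -> integrable_on a b g ->
  itg a b (fun r => f r - g r) = itg a b f - itg a b g.
Proof. by move=> fi gi; exact: RintegralB. Qed.

Lemma itgZ a b f c : integrable_on a b f ->
  itg a b (fun r => c * f r) = c * itg a b f.
Proof. by move=> fi; exact: RintegralZl. Qed.

Lemma itg_cst a b c : a <= b -> itg a b (fun=> c) = c * (b - a).
Proof.
move=> ab; rewrite /itg Rintegral_cst //= lebesgue_measure_itv /= lte_fin.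
by move: ab; rewrite le_eqVlt => /predU1P[->|->] //; rewrite ltxx subrr.
Qed.

Lemma le_itg a b f g : integrable_on a b f -> integrable_on a b g ->
  (forall r, a <= r <= b -> f r <= g r) -> itg a b f <= itg a b g.
Proof.
move=> fi gi fg; apply: le_Rintegral => // r /=; rewrite in_itv; exact: fg.
Qed.

Lemma itg_ge0 a b f : (forall r, a <= r <= b -> 0 <= f r) -> 0 <= itg a b f.
Proof. by move=> f0; apply: Rintegral_ge0 => r /=; rewrite in_itv; exact: f0. Qed.

Lemma norm_itg_le a b f g : integrable_on a b f -> integrable_on a b g ->
  (forall r, a <= r <= b -> `|f r| <= g r) -> `|itg a b f| <= itg a b g.
Proof.
move=> fi gi fg; rewrite ler_norml; apply/andP; split.
  rewrite -mulN1r -itgZ //; apply: le_itg => // [|r /fg]; first exact: integrable_onZ.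
  by rewrite mulN1r ler_norml => /andP[].
by apply: le_itg => // r /fg; rewrite ler_norml => /andP[].
Qed.

Lemma norm_itg_le_cst a b f c : a <= b -> integrable_on a b f ->
  (forall r, a <= r <= b -> `|f r| <= c) -> `|itg a b f| <= c * (b - a).
Proof.
by move=> ab fi fc; rewrite -itg_cst //; apply: norm_itg_le => //; exact: integrable_on_cst.
Qed.

Lemma itg_chasles a m b f : a <= m -> m <= b -> integrable_on a b f ->
  itg a b f = itg a m f + itg m b f.
Proof.
move=> am mb fi; rewrite /itg -[X in _ = _ + X]Rintegral_itv_obnd_cbnd; last first.
  by apply: integrableS fi => //; apply: subset_itv; rewrite bnd_simp.
rewrite -(Rintegral_itvB fi) ?bnd_simp //; ring.
Qed.

(** A translate of Lebesgue measure has the right value on the half-open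
intervals, which determine the measure. *)
Lemma lebesgue_measure_translation (h : R) (A : set (measurableTypeR R)) :
  measurable A ->
  pushforward (@lebesgue_measure R) (fun r : measurableTypeR R => r + h : measurableTypeR R) A
  = lebesgue_measure A.
Proof.
move=> mA.
have mphi : measurable_fun setT (fun r : measurableTypeR R => r + h : measurableTypeR R).
  by apply: (@continuous_measurable_fun R) => x; apply: cvgD; [exact: cvg_id | exact: cvg_cst].
pose phi : {mfun measurableTypeR R >-> measurableTypeR R} :=
  HB.pack (fun r : measurableTypeR R => r + h : measurableTypeR R)
    (isMeasurableFun.Build _ _ _ _ _ mphi).
apply/esym/(@lebesgue_measure_unique R (pushforward lebesgue_measure phi)) => //.
move=> _ [[x y] _ <-] /=; rewrite /pushforward /=.
have -> : (fun r : R => r + h) @^-1` `]x, y]%classic = `](x - h), (y - h)]%classic.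
  by apply/seteqP; split => r /=; rewrite !in_itv /= ltrBlDr lerBrDr.
rewrite !lebesgue_measure_itv /= !lte_fin ltrD2r.
by case: ifP => // _; rewrite -!EFinB; congr EFin; ring.
Qed.

(** The bound c makes f + c nonnegative, so that the change of variables for
nonnegative functions applies. *)
Lemma itg_shift a b f h c : a <= b ->
  integrable_on a b (fun r => f (r + h)) -> integrable_on (a + h) (b + h) f ->
  (forall r, a + h <= r <= b + h -> `|f r| <= c) ->
  itg a b (fun r => f (r + h)) = itg (a + h) (b + h) f.
Proof.
move=> ab fhi fi fc.
have mphi : measurable_fun setT (fun r : measurableTypeR R => r + h : measurableTypeR R).
  by apply: (@continuous_measurable_fun R) => x; apply: cvgD; [exact: cvg_id | exact: cvg_cst].
have ec : itg a b (fun=> c) = itg (a + h) (b + h) (fun=> c).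
  by rewrite !itg_cst ?lerD2r //; congr (_ * _); ring.
suff : itg a b (fun r => f (r + h) + c) = itg (a + h) (b + h) (fun r => f r + c).
  rewrite !itgD ?ec //; first exact: addIr; exact: integrable_on_cst.
have fci : integrable_on (a + h) (b + h) (fun r => f r + c).
  by apply: integrable_onD => //; exact: integrable_on_cst.
rewrite /itg /Rintegral; congr fine.
rewrite -[in RHS](eq_measure_integral _ (m1 := pushforward (@lebesgue_measure R)
  (fun r : measurableTypeR R => r + h : measurableTypeR R))); last first.
  by move=> A mA _; exact: lebesgue_measure_translation.
rewrite ge0_integral_pushforward //; last 2 first.
- by have /measurable_int := fci.
- move=> y; rewrite inE /= in_itv /= => /fc; rewrite ler_norml => /andP[h1 _].
  by rewrite /= lee_fin -lerBlDr sub0r.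
rewrite (_ : _ @^-1` _ = `[a, b]%classic) //.
by apply/seteqP; split => r /=; rewrite !in_itv /= !lerD2r.
Qed.

End integral.

(** * Strong continuity and measurability *)

Section continuity.
Context {R : realType}.

Lemma within_comp (T T' : topologicalType) (S : topologicalType) (D : set T) (E : set T')
    (phi : T -> T') (g : T' -> S) :
  continuous phi -> (forall t, D t -> E (phi t)) ->
  {within E, continuous g} -> {within D, continuous (fun t => g (phi t))}.
Proof.
move=> cphi DE /subspace_continuousP cg; apply/subspace_continuousP => t Dt.
apply: cvg_trans (cg _ (DE _ Dt)) => A /= hA.
have h : nbhs t (fun r => E (phi r) -> A (g (phi r))) := cphi t _ hA.
change (nbhs t (fun r => D r -> A (g (phi r)))).
by apply: (filterS _ h) => r hr Dr; exact/hr/DE.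
Qed.

Lemma within_ip (T : topologicalType) (D : set T) (V : hilbertType R) (f g : T -> V) :
  {within D, continuous f} -> {within D, continuous g} ->
  {within D, continuous (fun t => ip (f t) (g t))}.
Proof.
move=> cf cg.
have -> : (fun t => ip (f t) (g t)) =
    (fun t => 4^-1 * (`|f t + g t| ^+ 2 - `|f t - g t| ^+ 2)).
  apply/funext => t; rewrite -!ipp ipBl ipDl !(ipBr, ipDr) (ipC (g t) (f t)).
  by field.
move=> t.
have c1 : (`|f r + g r|) @[r --> (t : subspace D)] --> `|f t + g t|.
  by apply: cvg_norm; apply: cvgD; [exact: cf | exact: cg].
have c2 : (`|f r - g r|) @[r --> (t : subspace D)] --> `|f t - g t|.
  by apply: cvg_norm; apply: cvgB; [exact: cf | exact: cg].
by apply: cvgM; [exact: cvg_cst | apply: cvgB; rewrite !expr2; apply: cvgM].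
Qed.

Lemma within_apply (T : topologicalType) (D : set T) (V W : normedModType R)
    (F : T -> 'L(V, W)) (p : T -> V) (c : R) :
  (forall x, {within D, continuous (fun t => F t x)}) ->
  (forall t x, D t -> `|F t x| <= c * `|x|) ->
  {within D, continuous p} -> {within D, continuous (fun t => F t (p t))}.
Proof.
move=> cF bF cp; apply/subspace_continuousP => t Dt.
have /subspace_continuousP/(_ t Dt) cFt := cF (p t).
have /subspace_continuousP/(_ t Dt) cpt := cp.
apply/cvgrPdist_le => e e0.
have e2 : 0 < e / 2 by rewrite divr_gt0.
have d0 : 0 < e / 2 / (`|c| + 1) by rewrite divr_gt0 // ltr_wpDl.
have /cvgrPdist_le/(_ _ e2) := cFt; have /cvgrPdist_le/(_ _ d0) := cpt.
rewrite !near_withinE; apply: filterS2 => r h1 h2 Dr.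
have -> : F t (p t) - F r (p r) = (F t (p t) - F r (p t)) + F r (p t - p r).
  by rewrite linearB addrA subrK.
apply: le_trans (ler_normD _ _) _; rewrite [leRHS]splitr lerD ?h2 //.
apply: le_trans (bF _ _ Dr) _; apply: (@le_trans _ _ ((`|c| + 1) * `|p t - p r|)).
  by rewrite ler_wpM2r // ler_wpDr // ler_norm.
rewrite mulrC -ler_pdivlMr; last by rewrite ltr_wpDl.
exact: h1.
Qed.

(** Pointwise bounds come from compactness, the uniform one from the
Banach-Steinhaus theorem. *)
Lemma strong_bounded (T : topologicalType) (K : set T) (V : hilbertType R)
    (W : normedModType R) (F : T -> 'L(V, W)) : compact K ->
  (forall x, {within K, continuous (fun t => F t x)}) ->
  exists2 c : R, 0 <= c & forall t x, K t -> `|F t x| <= c * `|x|.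
Proof.
move=> cK cF.
pose S : set (V -> W) := [set (F t : V -> W) | t in K].
have : uniform_bounded S.
  apply: Banach_Steinhauss => [_ [t Kt <-]|x].
    split; first exact: bounded_fun_normP.
    by move=> a u v; rewrite linearP.
  have /compact_bounded [M [_ hM]] : compact ((fun t => F t x) @` K).
    exact: continuous_compact.
  exists (M + 1) => _ [t Kt <-]; apply: hM; first by rewrite ltrDl.
  by exists t.
move=> /(_ 1) [M hM]; exists `|M| => // t x Kt.
have [->|x0] := eqVneq x 0; first by rewrite linear0 !normr0 mulr0.
have nx : 0 < `|x| by rewrite normr_gt0.
have := hM (F t) (ex_intro2 _ _ _ Kt erefl) (`|x|^-1 *: x).
rewrite linearZ /= !normrZ normfV normr_id mulVf ?gt_eqF // => /(_ (lexx _)) h.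
by rewrite -ler_pdivrMr // mulrC; apply: le_trans h (ler_norm _).
Qed.

Context {U : hilbertType R} (eps : R) (eps_gt0 : 0 < eps) (Q : R -> 'L(U, U))
  (Qc : forall t, coercive eps (Q t)) (cQ : strongly_continuous Q).

(** Adjoints of strongly continuous families are continuous in this sense only. *)
Definition weakly_continuous (a b : R) (w : R -> U) :=
  forall v, {within `[a, b], continuous (fun r => ip v (w r))}.

Lemma weakly_continuousD a b w1 w2 : weakly_continuous a b w1 ->
  weakly_continuous a b w2 -> weakly_continuous a b (fun r => w1 r + w2 r).
Proof.
move=> c1 c2 v; have -> : (fun r => ip v (w1 r + w2 r)) =
  (fun r => ip v (w1 r) + ip v (w2 r)) by apply/funext => r; rewrite ipDr.
by move=> t; apply: cvgD; [exact: c1 | exact: c2].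
Qed.

Lemma weakly_continuousB a b w1 w2 : weakly_continuous a b w1 ->
  weakly_continuous a b w2 -> weakly_continuous a b (fun r => w1 r - w2 r).
Proof.
move=> c1 c2 v; have -> : (fun r => ip v (w1 r - w2 r)) =
  (fun r => ip v (w1 r) - ip v (w2 r)) by apply/funext => r; rewrite ipBr.
by move=> t; apply: cvgB; [exact: c1 | exact: c2].
Qed.

(** The function is lower semicontinuous, as a supremum of continuous ones. *)
Lemma measurable_inverse_diag a b w : weakly_continuous a b w ->
  measurable_fun `[a, b] (fun r => ip (inverse (Q r) (w r)) (w r)).
Proof.
move=> cw mD; apply: (measurability _ (RGenOInfty.measurableE R)) => //.
move=> _ [_ [x ->] <-].
pose D := `[a, b]%classic : set R.
pose O : set (subspace D) :=
  \bigcup_v [set r | x < ip v (w r) *+ 2 - ip (Q r v) v].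
have -> : D `&` (fun r => ip (inverse (Q r) (w r)) (w r)) @^-1` `]x, +oo[ = D `&` O.
  apply/seteqP; split => r [Dr]; rewrite /= in_itv /= ?andbT => h; split => //.
    exists (inverse (Q r) (w r)) => //=.
    by rewrite (inverseK _ eps_gt0 (Qc r)) (ipC (w r)) mulr2n addrK.
  case: h => v _ /= /lt_le_trans; apply.
  exact: (inverse_sup eps_gt0 _ _ (Qc r)).
apply: open_measurable_subspace => //; apply: bigcup_open => v _.
have cv : continuous ((fun r => ip v (w r) *+ 2 - ip (Q r v) v) : subspace D -> R).
  move=> t; apply: cvgB; first by apply: cvgMn; exact: cw.
  apply: (@within_ip _ D U (fun r => Q r v) (fun=> v)); last exact: cst_continuous.
  by apply: continuous_subspaceT; exact: cQ.
apply: (@open_comp _ _ _ [set y : R | x < y] (fun t _ => cv t)).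
have -> : [set y : R | x < y] = `]x, +oo[%classic.
  by apply/seteqP; split => y /=; rewrite in_itv /= andbT.
exact: interval_open.
Qed.

Lemma measurable_inverse a b w1 w2 : weakly_continuous a b w1 ->
  weakly_continuous a b w2 ->
  measurable_fun `[a, b] (fun r => ip (inverse (Q r) (w1 r)) (w2 r)).
Proof.
move=> c1 c2.
pose d (w : R -> U) (r : R) : R := ip (inverse (Q r) (w r)) (w r).
have -> : (fun r => ip (inverse (Q r) (w1 r)) (w2 r)) =
  (fun r => 4^-1 * (d (fun r => w1 r + w2 r) r - d (fun r => w1 r - w2 r) r)).
  apply/funext => r; rewrite /d.
  set q := inverse (Q r).
  have qD u v : q (u + v) = q u + q v.
    by apply: ip_ext => z; rewrite ipDl !(inverse_sym eps_gt0 _ _ (Qc r)) ipDl.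
  have qB u v : q (u - v) = q u - q v.
    by apply: ip_ext => z; rewrite ipBl !(inverse_sym eps_gt0 _ _ (Qc r)) ipBl.
  rewrite qD qB ipBl ipDl !(ipBr, ipDr) (inverse_sym eps_gt0 (w2 r) (w1 r) (Qc r)) -/q (ipC (w2 r)).
  by field.
apply: measurable_funM; first exact: measurable_cst.
apply: measurable_funB; apply: measurable_inverse_diag.
- exact: weakly_continuousD.
- exact: weakly_continuousB.
Qed.

End continuity.

Section itv_apply.
Context {R : realType}.

Lemma itv_apply (V : hilbertType R) (W : normedModType R) (F : R -> 'L(V, W))
    (p : R -> V) (a b : R) :
  (forall x, {within `[a, b], continuous (fun t => F t x)}) ->
  {within `[a, b], continuous p} -> {within `[a, b], continuous (fun t => F t (p t))}.
Proof.
move=> cF; have [c _ hc] := strong_bounded (@segment_compact R a b) cF.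
exact: within_apply hc.
Qed.

Lemma itv_bounded (V : normedModType R) (p : R -> V) (a b : R) :
  {within `[a, b], continuous p} ->
  exists2 c : R, 0 <= c & forall t, a <= t <= b -> `|p t| <= c.
Proof.
move=> cp; have /compact_bounded [M [_ hM]] : compact (p @` `[a, b]).
  by apply: continuous_compact => //; exact: segment_compact.
exists (`|M| + 1); first by rewrite addr_ge0.
move=> t h; apply: (hM (`|M| + 1)).
  by apply: le_lt_trans (ler_norm _) _; rewrite ltrDl.
by exists t => //=; rewrite in_itv.
Qed.

Lemma integrable_on_continuous (f : R -> R) (a b : R) :
  {within `[a, b], continuous f} -> integrable_on a b f.
Proof. by move=> cf; apply: continuous_compact_integrable => //; exact: segment_compact. Qed.

End itv_apply.

(** * The Riccati equation between arbitrary times *)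

Section lq.
Context {R : realType} {H U : hilbertType R}.

Record lq_system (UA : R -> R -> 'L(H, H)) (B : R -> 'L(U, H))
    (C : R -> 'L(H, H)) (Q : R -> 'L(U, U)) (eps b c : R) : Prop := LqSystem {
  lq_cont : forall x, {within [set p : R * R | p.2 <= p.1],
    continuous (fun p => UA p.1 p.2 x)} ;
  lq_id : forall s x, UA s s x = x ;
  lq_comp : forall s r t x, s <= r -> r <= t -> UA t r (UA r s x) = UA t s x ;
  lq_contB : strongly_continuous B ;
  lq_contC : strongly_continuous C ;
  lq_contQ : strongly_continuous Q ;
  lq_eps : 0 < eps ;
  lq_coercive : forall t, coercive eps (Q t) ;
  lq_b : 0 <= b ;
  lq_normB : forall t u, `|B t u| <= b * `|u| ;
  lq_c : 0 <= c ;
  lq_normC : forall t x, `|C t x| <= c * `|x|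
}.

Arguments lq_cont {_ _ _ _ _ _ _} _ x.

Context (UA : R -> R -> 'L(H, H)) (B : R -> 'L(U, H))
    (C : R -> 'L(H, H)) (Q : R -> 'L(U, U)) (eps b c : R).
Context (S : lq_system UA B C Q eps b c).

Definition lq_gain (r : R) (x : H) : H := feedback (B r) (Q r) x.

Lemma lq_gainB r x y : lq_gain r (x - y) = lq_gain r x - lq_gain r y.
Proof. exact: feedbackB (lq_eps S) _ _ (lq_coercive S r) _ _. Qed.

Lemma lq_gain_sym r x y : ip (lq_gain r x) y = ip x (lq_gain r y).
Proof. exact: feedback_sym (lq_eps S) _ _ (lq_coercive S r) _ _. Qed.

Lemma lq_gain_ge0 r x : 0 <= ip (lq_gain r x) x.
Proof. exact: feedback_ge0 (lq_eps S) _ _ (lq_coercive S r) _. Qed.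

Definition gbound : R := b ^+ 2 / eps.

Lemma gbound_ge0 : 0 <= gbound.
Proof. by rewrite divr_ge0 ?exprn_ge0 ?lq_b ?(ltW (lq_eps S)) // (lq_b S). Qed.

Lemma norm_lq_gain r x : `|lq_gain r x| <= gbound * `|x|.
Proof. exact: norm_feedback (lq_eps S) _ _ (lq_coercive S r) _ (lq_b S) (lq_normB S r) _. Qed.

Lemma evolution_cont_fst s t y : {within `[s, t], continuous (fun r => UA r s y)}.
Proof.
refine (@within_comp _ _ _ `[s, t]%classic _ (fun r : R => (r, s)) _ _ _ (lq_cont S y)).
  by move=> r; apply: (@cvg_pair _ _ _ (nbhs r) (nbhs r) (nbhs s)); [exact: cvg_id | exact: cvg_cst].
by move=> r /=; rewrite in_itv /= => /andP[].
Qed.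

Lemma evolution_cont_snd s t y : {within `[s, t], continuous (fun r => UA t r y)}.
Proof.
refine (@within_comp _ _ _ `[s, t]%classic _ (fun r : R => (t, r)) _ _ _ (lq_cont S y)).
  by move=> r; apply: (@cvg_pair _ _ _ (nbhs r) (nbhs t) (nbhs r)); [exact: cvg_cst | exact: cvg_id].
by move=> r /=; rewrite in_itv /= => /andP[].
Qed.

Arguments evolution_cont_fst : clear implicits.
Arguments evolution_cont_snd : clear implicits.

Lemma weakly_continuous_adjB s t p : {within `[s, t], continuous p} ->
  weakly_continuous s t (fun r => adjoint (B r) (p r)).
Proof.
move=> cp v; have -> : (fun r => ip v (adjoint (B r) (p r))) = (fun r => ip (B r v) (p r)).
  by apply/funext => r; rewrite adjointP.
by apply: within_ip => //; apply: continuous_subspaceT; exact: lq_contB S _.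
Qed.

Lemma integrable_gain s t p1 p2 :
  {within `[s, t], continuous p1} -> {within `[s, t], continuous p2} ->
  integrable_on s t (fun r => ip (lq_gain r (p1 r)) (p2 r)).
Proof.
move=> c1 c2; have [m1 m1_ge0 b1] := itv_bounded c1; have [m2 m2_ge0 b2] := itv_bounded c2.
apply: (@integrable_on_bounded _ _ _ _ (gbound * m1 * m2)).
  have -> : (fun r => ip (lq_gain r (p1 r)) (p2 r)) =
    (fun r => ip (inverse (Q r) (adjoint (B r) (p1 r))) (adjoint (B r) (p2 r))).
    by apply/funext => r; rewrite /lq_gain feedbackE.
  by apply: (measurable_inverse (lq_eps S) (lq_coercive S) (lq_contQ S));
    exact: weakly_continuous_adjB.
move=> r h; apply: ip_ub; last exact: b2.
by apply: le_trans (norm_lq_gain _ _) _; rewrite ler_wpM2l ?gbound_ge0 ?b1.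
Qed.

(** Moving U_A(t,r) and B(r) to the other side leaves Q^-1 between two weakly
continuous functions. *)
Lemma integrable_evolution_gain s t p w : {within `[s, t], continuous p} ->
  integrable_on s t (fun r => ip (UA t r (lq_gain r (p r))) w).
Proof.
move=> cp; have [m m_ge0 bp] := itv_bounded cp.
have [M M_ge0 bU] := strong_bounded (@segment_compact R s t) (evolution_cont_snd s t).
apply: (@integrable_on_bounded _ _ _ _ (M * (gbound * m) * `|w|)).
  have -> : (fun r => ip (UA t r (lq_gain r (p r))) w) =
    (fun r => ip (inverse (Q r) (adjoint (B r) (p r))) (adjoint (B r) (adjoint (UA t r) w))).
    by apply/funext => r; rewrite adjointP /lq_gain feedbackE.
  apply: (measurable_inverse (lq_eps S) (lq_coercive S) (lq_contQ S)).
    exact: weakly_continuous_adjB.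
  move=> v; have -> : (fun r => ip v (adjoint (B r) (adjoint (UA t r) w))) =
    (fun r => ip (UA t r (B r v)) w) by apply/funext => r; rewrite -!adjointP.
  apply: (@within_ip _ _ _ _ (fun r => UA t r (B r v)) (fun=> w)); last exact: cst_continuous.
  apply: itv_apply; first exact: evolution_cont_snd.
  by apply: continuous_subspaceT; exact: lq_contB S _.
move=> r h; apply: ip_ub => //; have rst : `[s, t]%classic r by rewrite /= in_itv.
apply: le_trans (bU _ _ rst) _; rewrite ler_wpM2l //.
by apply: le_trans (norm_lq_gain _ _) _; rewrite ler_wpM2l ?gbound_ge0 ?bp.
Qed.

Definition riccati_integrand (P : R -> 'L(H, H)) s x y (r : R) : R :=
  ip (lq_gain r (P r (UA r s x))) (P r (UA r s y)) - ip (C r (UA r s x)) (C r (UA r s y)).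

(** The mild Riccati equation restarted at any time t between s and the terminal
time, tested against a vector: this form restricts to subintervals, can be glued,
and gives increments over one short step. *)
Definition riccati_on (t0 t1 : R) (P : R -> 'L(H, H)) : Prop :=
  [/\ forall t, t0 <= t <= t1 -> nonneg_selfadjoint (P t),
      forall x, {within `[t0, t1], continuous (fun t => P t x)} &
      forall s t x y, t0 <= s -> s <= t -> t <= t1 ->
        ip (P s x) y = ip (P t (UA t s x)) (UA t s y)
                       - itg s t (riccati_integrand P s x y)].

Section local.
Context (t0 t1 : R) (P : R -> 'L(H, H)).
Context (cP : forall x, {within `[t0, t1], continuous (fun t => P t x)}).

Lemma cont_along s t x : t0 <= s -> t <= t1 ->
  {within `[s, t], continuous (fun r => P r (UA r s x))}.
Proof.
move=> s0 tT; apply: itv_apply; last exact: evolution_cont_fst.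
move=> y; apply: (continuous_subspaceW _ (@cP y)).
by apply: subset_itv; rewrite bnd_simp.
Qed.

Lemma cont_C_along s t x : {within `[s, t], continuous (fun r => C r (UA r s x))}.
Proof.
apply: itv_apply; last exact: evolution_cont_fst.
by move=> y; apply: continuous_subspaceT; exact: lq_contC S _.
Qed.

Lemma integrable_C_along s t x y :
  integrable_on s t (fun r => ip (C r (UA r s x)) (C r (UA r s y))).
Proof. by apply: integrable_on_continuous; apply: within_ip; exact: cont_C_along. Qed.

Lemma integrable_riccati s t x y : t0 <= s -> t <= t1 ->
  integrable_on s t (riccati_integrand P s x y).
Proof.
move=> s0 tT; apply: integrable_onB; last exact: integrable_C_along.
by apply: integrable_gain; exact: cont_along.
Qed.

End local.

Lemma ip_adjoint (V W : hilbertType R) (f : 'L(V, W)) x y : ip (adjoint f y) x = ip y (f x).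
Proof. by rewrite ipC -adjointP ipC. Qed.

(** The evolution property makes the integrand independent of the time at which
the evolution is restarted. *)
Lemma itg_cocycle P s t t' x y : s <= t -> t <= t' ->
  itg t t' (riccati_integrand P t (UA t s x) (UA t s y)) =
  itg t t' (riccati_integrand P s x y).
Proof.
move=> st tt'; apply: eq_itg => r /andP[tr _].
by rewrite /riccati_integrand !(lq_comp S).
Qed.

Lemma mild_riccati T P : mild_solution UA B C Q T P -> riccati_on 0 T P.
Proof.
move=> [Pn cP mP]; split=> //.
have key s x y : 0 <= s <= T -> ip (P s x) y =
    ip (P T (UA T s x)) (UA T s y) - itg s T (riccati_integrand P s x y).
  move=> sT; have [I hI ->] := mP s x sT.
  rewrite ipBl ip_adjoint; congr (_ - _); have [_ e] := hI y; apply: (etrans e).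
  refine (@eq_itg _ s T _ _ _) => r /andP[sr rT].
  have Pr : nonneg_selfadjoint (P r).
    by apply: Pn; rewrite rT andbT; apply: le_trans sr; case/andP: sT.
  rewrite -/(ip _ _) ip_adjoint ipBl ip_adjoint.
  by rewrite (nsa_sym _ _ Pr).
move=> s t x y s0 st tT; rewrite (key s) ?s0 ?(le_trans st) // (key t) ?tT ?(le_trans s0) //.
rewrite !(lq_comp S) // (itg_cocycle _ _ _ st tT) (itg_chasles st tT); first by ring.
exact: (integrable_riccati cP).
Qed.

Lemma riccati_sub t0 t1 s0 s1 P : t0 <= s0 -> s1 <= t1 ->
  riccati_on t0 t1 P -> riccati_on s0 s1 P.
Proof.
move=> h0 h1 [Pn cP eP]; split.
- by move=> t /andP[a1 a2]; apply: Pn; rewrite (le_trans h0) // (le_trans a2).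
- by move=> x; apply: (continuous_subspaceW _ (cP x)); apply: subset_itv; rewrite bnd_simp.
- move=> s t x y hs st ht; apply: eP => //; [exact: le_trans hs | exact: le_trans h1].
Qed.

Lemma riccati_cat t0 t1 t2 P : t0 <= t1 -> t1 <= t2 ->
  riccati_on t0 t1 P -> riccati_on t1 t2 P -> riccati_on t0 t2 P.
Proof.
move=> h01 h12 [n1 c1 e1] [n2 c2 e2].
have cP x : {within `[t0, t2], continuous (fun t => P t x)}.
  have -> : `[t0, t2]%classic = (`[t0, t1] `|` `[t1, t2])%classic.
    apply/seteqP; split => r /=; rewrite !in_itv /=.
      by move=> /andP[ar rb]; case: (leP r t1) => h; [left|right]; rewrite ?ar ?rb ?(ltW h).
    by move=> [|] /andP[h1 h2]; rewrite ?h1 ?h2 ?(le_trans h2 h12) ?(le_trans h01 h1).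
  by apply: withinU_continuous => //; exact: itv_closed.
split => // [t /andP[a1 a2]|s t x y s0 st tT].
  by case: (leP t t1) => h; [apply: n1 | apply: n2]; rewrite ?a1 ?a2 // ltW.
case: (leP t t1) => htt; first exact: e1.
case: (leP t1 s) => hst; first exact: e2.
rewrite (e1 s t1) ?(ltW hst) // (e2 t1 t) ?(ltW htt) // !(lq_comp S) ?(ltW hst) ?(ltW htt) //.
rewrite (itg_cocycle _ _ _ (ltW hst) (ltW htt)) (itg_chasles (ltW hst) (ltW htt)); first by ring.
exact: (integrable_riccati cP).
Qed.

End lq.

(** * Periodic extension of a solution *)

Section periodic_extension.
Context {R : realType} {H U : hilbertType R}.
Context (UA : R -> R -> 'L(H, H)) (B : R -> 'L(U, H))
    (C : R -> 'L(H, H)) (Q : R -> 'L(U, U)) (eps b c : R).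
Context (S : lq_system UA B C Q eps b c).
Local Notation gain := (lq_gain B Q).
Local Notation riccati := (riccati_on UA B C Q).
Local Notation density := (riccati_integrand UA B C Q).

Lemma bounded_riccati (t0 t1 : R) P (s t : R) x y :
  (forall x, {within `[t0, t1], continuous (fun t => (P t : 'L(H, H)) x)}) ->
  t0 <= s -> t <= t1 ->
  exists m : R, forall r, s <= r <= t -> `|density P s x y r| <= m.
Proof.
move=> cP s0 tT.
have [m1 m1_ge0 b1] := itv_bounded (cont_along S cP s0 tT (x := x)).
have [m2 m2_ge0 b2] := itv_bounded (cont_along S cP s0 tT (x := y)).
have [m3 m3_ge0 b3] := itv_bounded (cont_C_along S (s := s) (t := t) (x := x)).
have [m4 m4_ge0 b4] := itv_bounded (cont_C_along S (s := s) (t := t) (x := y)).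
exists (gbound eps b * m1 * m2 + m3 * m4) => r h.
apply: le_trans (ler_normB _ _) _; apply: lerD; apply: ip_ub => //; rewrite ?b2 ?b3 ?b4 //.
apply: le_trans (norm_lq_gain S _ _) _.
by rewrite ler_wpM2l ?b1 // (gbound_ge0 S).
Qed.

Context (theta : R) (theta_gt0 : 0 < theta)
    (UA_periodic : evolution_periodic theta UA)
    (B_periodic : op_periodic theta B) (C_periodic : op_periodic theta C)
    (Q_periodic : op_periodic theta Q).

Lemma gain_periodic r x : gain (r + theta) x = gain r x.
Proof.
rewrite /lq_gain /feedback B_periodic.
have -> : (B (r + theta) : U -> H) = B r by apply/funext => u; exact: B_periodic.
by have -> : (Q (r + theta) : U -> U) = Q r by apply/funext => u; exact: Q_periodic.
Qed.

Lemma riccati_shift t0 t1 P : op_periodic theta P ->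
  riccati t0 t1 P -> riccati (t0 + theta) (t1 + theta) P.
Proof.
move=> P_periodic [Pn cP eP].
have PE t : (P t : H -> H) = P (t - theta).
  by apply/funext => x; rewrite -(P_periodic (t - theta)) subrK.
have cP' x : {within `[t0 + theta, t1 + theta], continuous (fun t => P t x)}.
  have -> : (fun t => P t x) = (fun t => P (t - theta) x).
    by apply/funext => t; rewrite -(PE t).
  refine (@within_comp _ _ _ `[t0 + theta, t1 + theta]%classic _ (fun t : R => t - theta) _ _ _ (@cP x)).
    by move=> t; apply: cvgB; [exact: cvg_id | exact: cvg_cst].
  by move=> t /=; rewrite !in_itv /= lerBrDr lerBlDr.
split => //.
  move=> t /andP[h1 h2]; rewrite PE; apply: Pn.
  by rewrite lerBrDr h1 lerBlDr.
move=> s t x y; rewrite -(subrK theta s) -(subrK theta t).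
move: (s - theta) (t - theta) => {}s {}t; rewrite !lerD2r => s0 st tT.
rewrite !P_periodic (UA_periodic _ st) (UA_periodic _ st) (eP s t) //; congr (_ - _).
have E r : s <= r -> density P (s + theta) x y (r + theta) = density P s x y r.
  move=> sr; rewrite /riccati_integrand !(UA_periodic _ sr) !P_periodic.
  by rewrite gain_periodic !C_periodic.
have [m hm] := bounded_riccati x y cP s0 tT.
have fi := integrable_riccati S cP x y s0 tT.
have fhi : integrable_on s t (fun r => density P (s + theta) x y (r + theta)).
  by apply: eq_integrable_on fi => r /andP[sr _]; rewrite E.
rewrite -(@itg_shift _ s t _ theta m) //.
- by apply: eq_itg => r /andP[sr _]; rewrite E.
- by apply: (integrable_riccati S cP'); rewrite lerD2r.
- move=> r /andP[h1 h2]; rewrite -(subrK theta r) E ?lerBrDr //.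
  by apply: hm; rewrite lerBrDr h1 lerBlDr.
Qed.

Lemma riccati_periodic P k : op_periodic theta P -> riccati 0 theta P ->
  riccati 0 (theta *+ k.+1) P.
Proof.
move=> Pp hP; elim: k => [|k IH]; first by rewrite mulr1n.
have th0 : 0 <= theta := ltW theta_gt0.
apply: (riccati_cat S th0) => //.
  by rewrite mulrS lerDl mulrn_wge0.
by have := riccati_shift Pp IH; rewrite add0r [in X in _ -> X]mulrS addrC.
Qed.

End periodic_extension.

(** * One step of the closed loop *)

Section euler_step.
Context {R : realType} {H U : hilbertType R}.
Context (UA : R -> R -> 'L(H, H)) (B : R -> 'L(U, H))
    (C : R -> 'L(H, H)) (Q : R -> 'L(U, U)) (eps b c : R).
Context (S : lq_system UA B C Q eps b c).
Local Notation gain := (lq_gain B Q).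
Local Notation riccati := (riccati_on UA B C Q).
Local Notation density := (riccati_integrand UA B C Q).
Local Notation g := (gbound eps b).

Definition bounded_on (t0 t1 p : R) (P : R -> 'L(H, H)) : Prop :=
  0 <= p /\ forall r x, t0 <= r <= t1 -> `|P r x| <= p * `|x|.

Definition evolution_bounded (t0 t1 M : R) : Prop := 0 <= M /\
  forall s t x, t0 <= s -> s <= t -> t <= t1 -> `|UA t s x| <= M * `|x|.

(** y' approximates the state at time t of the closed loop of P started from y
at time s: the feedback acts along the free evolution of y instead of along the
unknown trajectory. *)
Definition is_step (P : R -> 'L(H, H)) (s t : R) (y y' : H) : Prop :=
  forall w, ip y' w = ip (UA t s y) w -
    itg s t (fun r => ip (UA t r (gain r (P r (UA r s y)))) w).

Definition step (P : R -> 'L(H, H)) (s t : R) (y : H) : H :=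
  xget 0 [set y' | is_step P s t y y'].

Context (t0 t1 M : R) (UM : evolution_bounded t0 t1 M).

Lemma norm_control (P : R -> 'L(H, H)) (p : R) s t r y : bounded_on t0 t1 p P ->
  t0 <= s -> s <= r -> r <= t -> t <= t1 ->
  `|UA t r (gain r (P r (UA r s y)))| <= M * (g * (p * (M * `|y|))).
Proof.
move=> [p_ge0 bP] s0 sr rt tT; have [M_ge0 bU] := UM.
have r0 : t0 <= r := le_trans s0 sr.
apply: le_trans (bU _ _ _ r0 rt tT) _; rewrite ler_wpM2l //.
apply: le_trans (norm_lq_gain S _ _) _; rewrite ler_wpM2l ?(gbound_ge0 S) //.
have rT := le_trans rt tT.
by apply: le_trans (bP _ _ _) _; rewrite ?r0 ?rT // ler_wpM2l // bU.
Qed.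

Lemma stepP P (p s t : R) y : riccati t0 t1 P -> bounded_on t0 t1 p P ->
  t0 <= s -> s <= t -> t <= t1 -> is_step P s t y (step P s t y).
Proof.
move=> [_ cP _] bP s0 st tT.
pose f w (r : R) : R := ip (UA t r (gain r (P r (UA r s y)))) w.
have fi w : integrable_on s t (f w).
  by apply: (integrable_evolution_gain S); exact: (cont_along S cP).
have [v hv] : exists v, forall w, ip v w = itg s t (f w).
  apply: (@riesz _ _ _ (M * (g * (p * (M * `|y|))) * (t - s))) => [a w1 w2|w].
    rewrite -itgZ // -itgD //; last exact: integrable_onZ.
    by apply: eq_itg => r _; rewrite /f ipDr ipZr.
  rewrite mulrAC; apply: norm_itg_le_cst => // r /andP[sr rt].
  by apply: ip_ub => //; apply: norm_control.
have : [set y' | is_step P s t y y'] (step P s t y).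
  by apply: xgetPex; exists (UA t s y - v) => w; rewrite ipBl hv.
exact.
Qed.

Lemma step_dist P (p s t : R) y y' : riccati t0 t1 P -> bounded_on t0 t1 p P ->
  t0 <= s -> s <= t -> t <= t1 -> is_step P s t y y' ->
  `|UA t s y - y'| <= M * (g * (p * (M * `|y|))) * (t - s).
Proof.
move=> [_ cP _] bP s0 st tT hy'; have [M_ge0 _] := UM; have [p_ge0 _] := bP.
apply: norm_le_ip => [|w].
  by have g_ge0 := gbound_ge0 S; rewrite !(g_ge0, mulr_ge0) ?subr_ge0.
rewrite ipBl hy' opprB addrC subrK mulrAC.
apply: norm_itg_le_cst => // [|r /andP[sr rt]].
  by apply: (integrable_evolution_gain S); exact: (cont_along S cP).
by apply: ip_ub => //; apply: norm_control.
Qed.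

Definition drift (p : R) : R := (g * p ^+ 2 + c ^+ 2) * M ^+ 2.

(** The Riccati equation also says that U_A(t,s)^* P(t) U_A(t,s) differs from P(s)
by O(t - s); this replaces any continuity of the adjoint of U_A. *)
Lemma riccati_drift P (p s t : R) x y : riccati t0 t1 P -> bounded_on t0 t1 p P ->
  t0 <= s -> s <= t -> t <= t1 ->
  `|ip (P s x) y - ip (P t (UA t s x)) (UA t s y)| <= drift p * `|x| * `|y| * (t - s).
Proof.
move=> [_ cP eP] [p_ge0 bP] s0 st tT; have [M_ge0 bU] := UM.
rewrite (eP s t) // addrC addKr normrN; apply: norm_itg_le_cst => //.
  exact: (integrable_riccati S cP).
move=> r /andP[sr rt]; have r0 := le_trans s0 sr; have rT := le_trans rt tT.
have hU z : `|UA r s z| <= M * `|z| by apply: bU.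
have hP z : `|P r (UA r s z)| <= p * (M * `|z|).
  by apply: le_trans (bP _ _ _) _; rewrite ?r0 ?rT // ler_wpM2l.
have hC z : `|C r (UA r s z)| <= c * (M * `|z|).
  by apply: le_trans (lq_normC S _ _) _; rewrite ler_wpM2l // (lq_c S).
apply: le_trans (ler_normB _ _) _.
have -> : drift p * `|x| * `|y| =
  (g * (p * (M * `|x|))) * (p * (M * `|y|)) + (c * (M * `|x|)) * (c * (M * `|y|)).
  by rewrite /drift; ring.
apply: lerD; apply: ip_ub => //.
by apply: le_trans (norm_lq_gain S _ _) _; rewrite ler_wpM2l ?(gbound_ge0 S).
Qed.

(** Minus the rate of change of (P2 y, y) under the feedback of P1. For P1 = P2 it
is the cost |C y|^2 + (Q u, u). *)
Definition energy (P1 P2 : R -> 'L(H, H)) (s : R) (y : H) (r : R) : R :=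
  2 * ip (gain r (P1 r (UA r s y))) (P2 r (UA r s y))
  - ip (gain r (P2 r (UA r s y))) (P2 r (UA r s y)) + `|C r (UA r s y)| ^+ 2.

Lemma integrable_energy P1 P2 s t y : riccati t0 t1 P1 -> riccati t0 t1 P2 ->
  t0 <= s -> t <= t1 -> integrable_on s t (energy P1 P2 s y).
Proof.
move=> [_ c1 _] [_ c2 _] s0 tT; apply: integrable_onD; last first.
  by apply: eq_integrable_on (integrable_C_along S s t y y) => r _; rewrite ipp.
apply: integrable_onB; first apply: integrable_onZ;
  by apply: (integrable_gain S); apply: (cont_along S).
Qed.

Definition defect (p1 p2 : R) : R :=
  2 * (drift p2 * M * (g * (p1 * M))) + p2 * (M * (g * (p1 * M))) ^+ 2.

(** The first order term of (P2 y', y') is the integral of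
(U_A(t,r) B u, P2(t) U_A(t,s) y), and [riccati_drift] moves P2 from time t to
time r at the cost of another factor t - s. *)
Lemma energy_step P1 P2 (p1 p2 s t : R) y y' :
  riccati t0 t1 P1 -> bounded_on t0 t1 p1 P1 ->
  riccati t0 t1 P2 -> bounded_on t0 t1 p2 P2 ->
  t0 <= s -> s <= t -> t <= t1 -> is_step P1 s t y y' ->
  `|ip (P2 s y) y - ip (P2 t y') y' - itg s t (energy P1 P2 s y)|
    <= defect p1 p2 * (t - s) ^+ 2 * `|y| ^+ 2.
Proof.
move=> h1 b1 h2 b2 s0 st tT hy'; have [n1 c1 e1] := h1; have [n2 c2 e2] := h2.
have [M_ge0 bU] := UM; have [p1_ge0 bP1] := b1; have [p2_ge0 bP2] := b2.
have g_ge0 := gbound_ge0 S.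
have ts_ge0 : 0 <= t - s by rewrite subr_ge0.
have t0t := le_trans s0 st.
pose eta r := UA r s y.
pose v := eta t - y'.
pose cross r : R := ip (gain r (P1 r (eta r))) (P2 r (eta r)).
pose tran r : R := ip (UA t r (gain r (P1 r (eta r)))) (P2 t (eta t)).
have hv w : ip v w = itg s t (fun r => ip (UA t r (gain r (P1 r (eta r)))) w).
  by rewrite /v ipBl hy' opprB addrC subrK.
have nv : `|v| <= M * (g * (p1 * (M * `|y|))) * (t - s) by apply: step_dist hy'.
have yE : y' = eta t - v by rewrite /v opprB addrC subrK.
clearbody v.
have crossi : integrable_on s t cross.
  by apply: (integrable_gain S); apply: (cont_along S).
have trani : integrable_on s t tran.
  by apply: (integrable_evolution_gain S); apply: (cont_along S).
have sym2 : nonneg_selfadjoint (P2 t) by apply: n2; rewrite t0t.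
have -> : ip (P2 s y) y - ip (P2 t y') y' - itg s t (energy P1 P2 s y) =
    2 * itg s t (fun r => tran r - cross r) - ip (P2 t v) v.
  rewrite itgB // -(hv (P2 t (eta t))).
  have -> : itg s t (energy P1 P2 s y) = 2 * itg s t cross - itg s t (density P2 s y y).
    rewrite -itgZ // -itgB //; [|exact: integrable_onZ|exact: (integrable_riccati S c2)].
    by apply: eq_itg => r _; rewrite /energy /riccati_integrand /cross ipp; ring.
  rewrite (e2 s t) // -/(eta t) yE.
  rewrite linearB /= !(ipBl, ipBr) (nsa_sym v (eta t) sym2).
  by rewrite (ipC v (P2 t (eta t))); ring.
have hcross r : s <= r <= t -> `|tran r - cross r| <=
    drift p2 * (M * `|y|) * (g * (p1 * (M * `|y|))) * (t - s).
  move=> /andP[sr rt]; have r0 := le_trans s0 sr; have rT := le_trans rt tT.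
  have n2r : nonneg_selfadjoint (P2 r) by apply: n2; rewrite r0.
  set z := gain r (P1 r (eta r)).
  have nz : `|z| <= g * (p1 * (M * `|y|)).
    apply: le_trans (norm_lq_gain S _ _) _; rewrite ler_wpM2l //.
    by apply: le_trans (bP1 _ _ _) _; rewrite ?r0 ?rT // ler_wpM2l // bU.
  have -> : tran r - cross r =
      - (ip (P2 r (eta r)) z - ip (P2 t (UA t r (eta r))) (UA t r z)).
    rewrite /tran /cross -/z (lq_comp S) // -/(eta t) (ipC z) (ipC (UA t r z)).
    by ring.
  rewrite normrN; apply: le_trans (riccati_drift _ _ h2 b2 r0 rt tT) _.
  have d_ge0 : 0 <= drift p2.
    by rewrite /drift mulr_ge0 ?addr_ge0 ?(mulr_ge0 g_ge0) ?exprn_ge0 ?(lq_c S).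
  apply: (@le_trans _ _ (drift p2 * (M * `|y|) * (g * (p1 * (M * `|y|))) * (t - r))).
    rewrite ler_wpM2r ?subr_ge0 //; apply: ler_pM => //; first exact: mulr_ge0.
    by rewrite ler_wpM2l // bU.
  by rewrite ler_wpM2l ?lerD2l ?lerN2 // !(d_ge0, g_ge0, mulr_ge0).
apply: le_trans (ler_normB _ _) _; rewrite normrM ger0_norm //.
have := norm_itg_le_cst st (integrable_onB trani crossi) hcross.
have : `|ip (P2 t v) v| <= p2 * (M * (g * (p1 * (M * `|y|))) * (t - s)) *
                              (M * (g * (p1 * (M * `|y|))) * (t - s)).
  apply: ip_ub => //; apply: le_trans (bP2 _ _ _) _; rewrite ?t0t //.
  by rewrite ler_wpM2l.
set X := `|itg _ _ _|; set Y := `|ip _ _|; rewrite /defect => hY hX.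
have -> : (2 * (drift p2 * M * (g * (p1 * M))) + p2 * (M * (g * (p1 * M))) ^+ 2)
    * (t - s) ^+ 2 * `|y| ^+ 2 =
  2 * (drift p2 * (M * `|y|) * (g * (p1 * (M * `|y|))) * (t - s) * (t - s)) +
  p2 * (M * (g * (p1 * (M * `|y|))) * (t - s)) * (M * (g * (p1 * (M * `|y|))) * (t - s)) by ring.
by rewrite lerD // ler_wpM2l.
Qed.

(** The two energies differ by the quadratic form of B Q^-1 B^* at (P1 - P2) y. *)
Lemma compare_step P1 P2 (p1 p2 s t : R) y y' :
  riccati t0 t1 P1 -> bounded_on t0 t1 p1 P1 ->
  riccati t0 t1 P2 -> bounded_on t0 t1 p2 P2 ->
  t0 <= s -> s <= t -> t <= t1 -> is_step P1 s t y y' ->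
  ip (P1 t y') y' - ip (P2 t y') y' <= ip (P1 s y) y - ip (P2 s y) y +
    (defect p1 p1 + defect p1 p2) * (t - s) ^+ 2 * `|y| ^+ 2.
Proof.
move=> h1 b1 h2 b2 s0 st tT hy'.
have := energy_step h1 b1 h1 b1 s0 st tT hy'; have := energy_step h1 b1 h2 b2 s0 st tT hy'.
have i11 := integrable_energy y h1 h1 s0 tT; have i12 := integrable_energy y h1 h2 s0 tT.
have : itg s t (energy P1 P2 s y) <= itg s t (energy P1 P1 s y).
  apply: le_itg => // r _; rewrite /energy lerD2r.
  have := lq_gain_ge0 S r (P1 r (UA r s y) - P2 r (UA r s y)).
  rewrite (lq_gainB S) ipBl !ipBr (lq_gain_sym S _ (P2 _ _) (P1 _ _)) (ipC (P2 _ _)).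
  have aux (x1 x2 x3 : R) : 0 <= x3 - x2 - (x2 - x1) -> 2 * x2 - x1 <= 2 * x3 - x3 by lra.
  exact: aux.
rewrite !ler_norml.
have -> : (defect p1 p1 + defect p1 p2) * (t - s) ^+ 2 * `|y| ^+ 2 =
  defect p1 p1 * (t - s) ^+ 2 * `|y| ^+ 2 + defect p1 p2 * (t - s) ^+ 2 * `|y| ^+ 2 by ring.
have aux (x1 x2 d1 d2 u u' v v' : R) : x1 <= x2 -> - d1 <= u - u' - x1 <= d1 ->
    - d2 <= v - v' - x2 <= d2 -> v' - u' <= v - u + (d2 + d1).
  by move=> ? /andP[? ?] /andP[? ?]; lra.
exact: aux.
Qed.

Lemma dissipation_step P (p s t : R) y y' :
  riccati t0 t1 P -> bounded_on t0 t1 p P ->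
  t0 <= s -> s <= t -> t <= t1 -> is_step P s t y y' ->
  itg s t (energy P P s y) <=
    ip (P s y) y - ip (P t y') y' + defect p p * (t - s) ^+ 2 * `|y| ^+ 2.
Proof.
move=> h1 b1 s0 st tT hy'.
have := energy_step h1 b1 h1 b1 s0 st tT hy'.
rewrite ler_norml => /andP[+ _].
have aux (x1 d u u' : R) : - d <= u - u' - x1 -> x1 <= u - u' + d by move=> ?; lra.
exact: aux.
Qed.

End euler_step.

(** * Chains of steps *)

Section chain.
Context {R : realType} {H U : hilbertType R}.
Context (UA : R -> R -> 'L(H, H)) (B : R -> 'L(U, H))
    (C : R -> 'L(H, H)) (Q : R -> 'L(U, U)) (eps b c : R).
Context (S : lq_system UA B C Q eps b c).
Local Notation gain := (lq_gain B Q).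
Local Notation riccati := (riccati_on UA B C Q).
Local Notation g := (gbound eps b).
Local Notation energy := (energy UA B C Q).

Context (t0 t1 M : R) (UM : evolution_bounded UA t0 t1 M) (t01 : t0 <= t1).

Definition mesh (n : nat) : R := (t1 - t0) / n%:R.
Definition node (n i : nat) : R := t0 + mesh n *+ i.

Lemma mesh_ge0 n : 0 <= mesh n.
Proof. by rewrite divr_ge0 ?subr_ge0. Qed.

Lemma node0 n : node n 0 = t0.
Proof. by rewrite /node mulr0n addr0. Qed.

Lemma nodenn n : (0 < n)%N -> node n n = t1.
Proof.
move=> n0; rewrite /node /mesh -[(_ / _) *+ n]mulr_natr divfK ?pnatr_eq0 -?lt0n //.
by rewrite addrC subrK.
Qed.

Lemma nodeS n i : node n i.+1 - node n i = mesh n.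
Proof. by rewrite /node mulrSr; ring. Qed.

Lemma node_le n i j : (i <= j)%N -> node n i <= node n j.
Proof.
move=> ij; rewrite lerD2l -[mesh n *+ i]mulr_natr -[mesh n *+ j]mulr_natr.
by rewrite ler_wpM2l ?ler_nat ?mesh_ge0.
Qed.

Lemma node_ge n i : t0 <= node n i.
Proof. by rewrite -[leLHS](node0 n) node_le. Qed.

Lemma node_le1 n i : (0 < n)%N -> (i <= n)%N -> node n i <= t1.
Proof. by move=> n0 ni; rewrite -(nodenn n0) node_le. Qed.

(** The induction is on the evolved quantity U_A(r, t_k) y_k for all later r, so
that the constant M appears only once. *)
Lemma discrete_duhamel n (y : nat -> H) k : (0 < n)%N -> (k <= n)%N ->
  `|y k| <= M * `|y 0| +
    M * \sum_(i < k) `|y i.+1 - UA (node n i.+1) (node n i) (y i)|.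
Proof.
move=> n0 kn; have [M_ge0 bU] := UM.
have : forall r, node n k <= r -> r <= t1 -> `|UA r (node n k) (y k)| <= M * `|y 0| +
    M * \sum_(i < k) `|y i.+1 - UA (node n i.+1) (node n i) (y i)|.
  elim: k kn => [|k IH] kn r kr rT.
    by rewrite big_ord0 mulr0 addr0 node0; apply: bU; rewrite // -(node0 n).
  have -> : y k.+1 = UA (node n k.+1) (node n k) (y k) +
      (y k.+1 - UA (node n k.+1) (node n k) (y k)) by rewrite addrC subrK.
  rewrite linearD /= (lq_comp S) // ?node_le //.
  apply: le_trans (ler_normD _ _) _; rewrite big_ord_recr /= mulrDr addrA.
  apply: lerD; last by apply: bU => //; exact: node_ge.
  by apply: IH => //; [exact: ltnW | apply: le_trans kr; exact: node_le].
move=> /(_ (node n k) (lexx _) (node_le1 n0 kn)).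
by rewrite (lq_id S).
Qed.

Fixpoint euler (P : R -> 'L(H, H)) (n : nat) (x : H) (i : nat) : H :=
  if i is j.+1 then step UA B Q P (node n j) (node n j.+1) (euler P n x j) else x.

(** An a priori bound for the chain that depends neither on the number of
steps nor on the initial value. *)
Definition growth (p : R) : R := M * expR (M * (M * (g * (p * M))) * (t1 - t0)).

Lemma growth_ge0 p : 0 <= growth p.
Proof. by have [M_ge0 _] := UM; rewrite mulr_ge0 // expR_ge0. Qed.

Lemma eulerP P (p : R) n x i : riccati t0 t1 P -> bounded_on t0 t1 p P ->
  (i < n)%N -> is_step UA B Q P (node n i) (node n i.+1) (euler P n x i) (euler P n x i.+1).
Proof.
move=> hP bP ni; have n0 : (0 < n)%N by apply: leq_ltn_trans ni.
by apply: (stepP S UM _ hP bP); rewrite ?node_ge ?node_le ?node_le1.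
Qed.

Lemma euler_bound P (p : R) n x k : riccati t0 t1 P -> bounded_on t0 t1 p P ->
  (0 < n)%N -> (k <= n)%N -> `|euler P n x k| <= growth p * `|x|.
Proof.
move=> hP bP n0 kn; have [M_ge0 bU] := UM; have [p_ge0 _] := bP.
have g_ge0 := gbound_ge0 S.
pose d := M * (M * (g * (p * M))) * mesh n.
have d_ge0 : 0 <= d by rewrite /d !(mesh_ge0, g_ge0, mulr_ge0).
have := @discrete_gronwall R (fun i => `|euler P n x i|) (M * `|x|) d n d_ge0 _ k kn.
move=> /(_ _)/le_trans -> //; last first.
  rewrite /growth [leRHS]mulrAC ler_wpM2l ?mulr_ge0 //.
  apply: le_trans (ler_weXn2l _ kn) _; first by rewrite lerDl.
  apply: le_trans (expr_le_expR _ d_ge0) _.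
  by rewrite ler_expR /d -mulrnAr -[mesh n *+ n]mulr_natr /mesh divfK // pnatr_eq0 -lt0n.
move=> j jn; apply: le_trans (discrete_duhamel _ n0 jn) _; rewrite lerD2l.
rewrite mulr_sumr mulr_sumr; apply: ler_sum => i _; rewrite distrC.
have ni : (i < n)%N := leq_trans (ltn_ord i) jn.
have := step_dist S UM hP bP (node_ge n i) (node_le n (leqnSn i))
  (node_le1 n0 ni) (eulerP x hP bP ni).
rewrite nodeS => h; apply: le_trans (ler_wpM2l M_ge0 h) _.
by rewrite /d le_eqVlt; apply/orP; left; apply/eqP; ring.
Qed.

Lemma defect_ge0 (p1 p2 : R) : 0 <= p1 -> 0 <= p2 -> 0 <= defect eps b c M p1 p2.
Proof.
move=> h1 h2; have [M_ge0 _] := UM; have g_ge0 := gbound_ge0 S.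
rewrite /defect /drift; apply: addr_ge0.
  rewrite !(g_ge0, mulr_ge0) // ?exprn_ge0 //.
  by rewrite addr_ge0 ?(mulr_ge0 g_ge0) ?exprn_ge0 // (lq_c S).
by rewrite mulr_ge0 // exprn_ge0 // !(g_ge0, mulr_ge0).
Qed.

Definition chain_defect (p1 p2 : R) (x : H) : R :=
  (defect eps b c M p1 p1 + defect eps b c M p1 p2) * (t1 - t0) ^+ 2 * (growth p1 * `|x|) ^+ 2.

Lemma step_defect (p1 p2 : R) P n x i : riccati t0 t1 P -> bounded_on t0 t1 p1 P ->
  0 <= p2 -> (i < n)%N ->
  defect eps b c M p1 p2 * mesh n ^+ 2 * `|euler P n x i| ^+ 2 <=
  defect eps b c M p1 p2 * (t1 - t0) ^+ 2 * (growth p1 * `|x|) ^+ 2 / n%:R ^+ 2.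
Proof.
move=> hP bP p2_ge0 ni; have [p1_ge0 _] := bP.
have n0 : (0 < n)%N by apply: leq_ltn_trans ni.
have D_ge0 := defect_ge0 p1_ge0 p2_ge0.
have -> : defect eps b c M p1 p2 * (t1 - t0) ^+ 2 * (growth p1 * `|x|) ^+ 2 / n%:R ^+ 2 =
  defect eps b c M p1 p2 * mesh n ^+ 2 * (growth p1 * `|x|) ^+ 2.
  by rewrite /mesh expr_div_n; ring.
rewrite ler_wpM2l //; first by rewrite (mulr_ge0 D_ge0) // exprn_ge0 // mesh_ge0.
have Gx : 0 <= growth p1 * `|x| by rewrite (mulr_ge0 (growth_ge0 _)).
by apply: lerXn2r; rewrite ?nnegrE // (euler_bound _ hP bP n0) // ltnW.
Qed.

Lemma sum_per_step (a : nat -> R) (e f : nat -> R) (K : R) n : (0 < n)%N ->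
  (forall i, (i < n)%N -> a i.+1 + f i <= a i + K / n%:R ^+ 2) ->
  a n + \sum_(i < n) f i <= a 0 + K / n%:R.
Proof.
move=> n0 h.
have key k : (k <= n)%N -> a k + \sum_(i < k) f i <= a 0 + K / n%:R ^+ 2 *+ k.
  elim: k => [|k IH] kn; first by rewrite big_ord0 mulr0n !addr0.
  rewrite big_ord_recr /= mulrSr addrA.
  have := IH (ltnW kn); have := h k kn.
  move: (\sum_(_ < _) _) (a k) (a k.+1) (f k) (K / _) (K / _ *+ k) (a 0) => u v w x y z t; lra.
have := key n (leqnn n).
rewrite -[(K / _) *+ n]mulr_natr.
by have -> : K / n%:R ^+ 2 * n%:R = K / n%:R by field; rewrite pnatr_eq0 -lt0n.
Qed.

(** Each of the n steps contributes an error of order 1/n^2. *)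
Lemma compare_chain P1 P2 (p1 p2 : R) n x :
  riccati t0 t1 P1 -> bounded_on t0 t1 p1 P1 ->
  riccati t0 t1 P2 -> bounded_on t0 t1 p2 P2 -> (0 < n)%N ->
  let y := euler P1 n x n in
  ip (P1 t1 y) y - ip (P2 t1 y) y <= ip (P1 t0 x) x - ip (P2 t0 x) x +
    chain_defect p1 p2 x / n%:R.
Proof.
move=> h1 b1 h2 b2 n0 /=; have [p1_ge0 _] := b1; have [p2_ge0 _] := b2.
pose y i := euler P1 n x i.
pose a i := ip (P1 (node n i) (y i)) (y i) - ip (P2 (node n i) (y i)) (y i).
have := @sum_per_step a (fun=> 0) (fun=> 0) (chain_defect p1 p2 x) n n0.
rewrite big1 // addr0 /a nodenn // node0; apply => i ni; rewrite addr0.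
have := compare_step S UM h1 b1 h2 b2 (node_ge n i) (node_le n (leqnSn i))
  (node_le1 n0 ni) (eulerP x h1 b1 ni).
move=> /le_trans; apply; rewrite nodeS lerD2l /chain_defect.
have := lerD (step_defect x h1 b1 p1_ge0 ni) (step_defect x h1 b1 p2_ge0 ni).
by rewrite -!mulrDl.
Qed.

Lemma dissipation_chain P (p : R) n x :
  riccati t0 t1 P -> bounded_on t0 t1 p P -> (0 < n)%N ->
  let y := euler P n x in
  ip (P t1 (y n)) (y n) +
    \sum_(i < n) itg (node n i) (node n i.+1) (energy P P (node n i) (y i))
  <= ip (P t0 x) x + chain_defect p p x / n%:R.
Proof.
move=> hP bP n0 /=; have [p_ge0 _] := bP.
pose y := euler P n x.
pose a i := ip (P (node n i) (y i)) (y i).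
pose f i := itg (node n i) (node n i.+1) (energy P P (node n i) (y i)).
have := @sum_per_step a (fun=> 0) f (chain_defect p p x) n n0.
rewrite /a nodenn // node0 => h; apply: h => i ni; rewrite addrC -lerBrDr.
have := dissipation_step S UM hP bP (node_ge n i) (node_le n (leqnSn i))
  (node_le1 n0 ni) (eulerP x hP bP ni).
move=> /le_trans; apply; rewrite nodeS addrAC lerD2r lerD2l /chain_defect.
have D := defect_ge0 p_ge0 p_ge0.
apply: le_trans (step_defect x hP bP p_ge0 ni) _.
have k_ge0 : 0 <= (t1 - t0) ^+ 2 * (growth p * `|x|) ^+ 2 / n%:R ^+ 2.
  by rewrite divr_ge0 ?sqr_ge0 // mulr_ge0 // sqr_ge0.
set D' := defect _ _ _ _ _ _ in D *.
have aux (u v w : R) : 0 <= u * v / w -> D' * u * v / w <= (D' + D') * u * v / w.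
  move=> uvw; have -> : (D' + D') * u * v / w = D' * u * v / w + D' * (u * v / w) by ring.
  by rewrite lerDl mulr_ge0.
exact: aux.
Qed.

End chain.

(** * Comparison with an observer over a window *)

Section window.
Context {R : realType} {H U : hilbertType R}.
Context (UA : R -> R -> 'L(H, H)) (B : R -> 'L(U, H))
    (C : R -> 'L(H, H)) (Q : R -> 'L(U, U)) (eps b c : R).
Context (S : lq_system UA B C Q eps b c).
Local Notation gain := (lq_gain B Q).
Local Notation riccati := (riccati_on UA B C Q).
Local Notation energy := (energy UA B C Q).

(** Closing the loop with the larger solution transports the sign of P1 - P2 from
the terminal time backwards. *)
Lemma riccati_order (t0 t1 M : R) P1 P2 (p1 p2 : R) x :
  evolution_bounded UA t0 t1 M -> t0 <= t1 ->
  riccati t0 t1 P1 -> bounded_on t0 t1 p1 P1 ->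
  riccati t0 t1 P2 -> bounded_on t0 t1 p2 P2 ->
  (forall y, ip (P2 t1 y) y <= ip (P1 t1 y) y) ->
  ip (P2 t0 x) x <= ip (P1 t0 x) x.
Proof.
move=> UM t01 h1 b1 h2 b2 h; rewrite -subr_ge0.
apply: (@le_of_harmonic _ _ _ (chain_defect eps b c t0 t1 M p1 p2 x)) => n n0.
have := compare_chain S UM t01 x h1 b1 h2 b2 n0.
by apply: le_trans; rewrite subr_ge0.
Qed.

Context (K : R -> 'L(H, H)) (k : R) (k_ge0 : 0 <= k)
  (K_le : forall t x, `|K t x| <= k * `|x|).

(** z is a mild trajectory of A + K C, in restarted and weak form. *)
Definition observer (t0 t1 : R) (z : R -> H) : Prop :=
  forall s t w, t0 <= s -> s <= t -> t <= t1 ->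
    integrable_on s t (fun r => ip (UA t r (K r (C r (z r)))) w) /\
    ip (z t) w = ip (UA t s (z s)) w + itg s t (fun r => ip (UA t r (K r (C r (z r)))) w).

Definition window_rate (M : R) : R := M * (b + b / eps + k).

Definition window_gap (M L : R) : R :=
  M * window_rate M * expR (M * (M * (k * (c * M))) * L) + 1.

Section gap.
Context (t0 t1 M : R) (UM : evolution_bounded UA t0 t1 M) (t01 : t0 <= t1).
Context (P : R -> 'L(H, H)) (p : R) (hP : riccati t0 t1 P) (bP : bounded_on t0 t1 p P).
Context (z : R -> H) (m : R) (hz : observer t0 t1 z)
  (z_le : forall r, t0 <= r <= t1 -> `|z r| <= m).

Lemma observer_drift s r : t0 <= s -> s <= r -> r <= t1 ->
  `|z r - UA r s (z s)| <= M * (k * (c * m)) * (r - s).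
Proof.
move=> s0 sr rT; have [M_ge0 bU] := UM.
have m_ge0 : 0 <= m by apply: le_trans (z_le (r := t0) _); rewrite ?lexx.
apply: norm_le_ip => [|w]; first by rewrite !mulr_ge0 ?subr_ge0 // (lq_c S).
have [fi e] := hz w s0 sr rT.
rewrite ipBl e addrC addKr mulrAC; apply: norm_itg_le_cst => // q /andP[sq qr].
have q0 := le_trans s0 sq; have qT := le_trans qr rT.
apply: ip_ub => //; apply: le_trans (bU _ _ _ q0 qr rT) _; rewrite ler_wpM2l //.
apply: le_trans (K_le _ _) _; rewrite ler_wpM2l //.
apply: le_trans (lq_normC S _ _) _; rewrite ler_wpM2l ?(lq_c S) //.
by apply: z_le; rewrite q0.
Qed.

Lemma energy_ge0 s y r : 0 <= energy P P s y r.
Proof.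
rewrite /energy; have := lq_gain_ge0 S r (P r (UA r s y)).
have : 0 <= `|C r (UA r s y)| ^+ 2 by rewrite exprn_ge0.
by move: (ip _ _) (_ ^+ 2) => u v ? ?; lra.
Qed.

(** Over one step the gap is driven by B u, which is bounded by the cost, and by
K C z. The latter is K C y, again bounded by the cost, up to the present gap, which
the discrete Gronwall lemma absorbs, and up to a drift of order t - s. *)
Lemma gap_step s t y y' (l : R) : t0 <= s -> s <= t -> t <= t1 -> 0 < l ->
  is_step UA B Q P s t y y' ->
  `|(y' - z t) - UA t s (y - z s)| <=
    window_rate M * (l * (t - s) + itg s t (energy P P s y) / l)
    + (M * (k * (c * M)) * `|y - z s| + M * (k * (c * (M * (k * (c * m))))) * (t - s)) * (t - s).
Proof.
move=> s0 st tT l_gt0 hy'; have [M_ge0 bU] := UM; have c_ge0 := lq_c S.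
have eps_gt0 := lq_eps S; have b_ge0 := lq_b S.
have m_ge0 : 0 <= m by apply: le_trans (z_le (r := t0) _); rewrite ?lexx.
have ts_ge0 : 0 <= t - s by rewrite subr_ge0.
pose eta r := UA r s y.
pose f w r := ip (UA t r (gain r (P r (eta r)))) w.
pose h w r := ip (UA t r (K r (C r (z r)))) w.
have fi w : integrable_on s t (f w).
  by have [_ cP _] := hP; apply: (integrable_evolution_gain S); apply: (cont_along S).
have hi w : integrable_on s t (h w) by have [] := hz w s0 st tT.
have Ei : integrable_on s t (energy P P s y) by apply: (integrable_energy S y hP hP).
pose rest : R := M * (k * (c * M)) * `|y - z s| + M * (k * (c * (M * (k * (c * m))))) * (t - s).
pose G r : R := window_rate M * l + window_rate M / l * energy P P s y r + rest.
have i1 : integrable_on s t (fun=> window_rate M * l) := integrable_on_cst _ _ _.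
have i2 := integrable_onZ (window_rate M / l) Ei.
have i3 : integrable_on s t (fun=> rest) := integrable_on_cst _ _ _.
have Gi : integrable_on s t G := integrable_onD (integrable_onD i1 i2) i3.
have -> : window_rate M * (l * (t - s) + itg s t (energy P P s y) / l) + rest * (t - s) = itg s t G.
  rewrite /G (itgD (integrable_onD i1 i2) i3) (itgD i1 i2) (itgZ _ Ei) !itg_cst //.
  by move: (itg _ _ _) => u; ring.
have rate_ge0 : 0 <= window_rate M.
  by rewrite /window_rate mulr_ge0 // !addr_ge0 // divr_ge0 // ltW.
have rest_ge0 : 0 <= rest by rewrite /rest addr_ge0 // !mulr_ge0.
have G_ge0 r : 0 <= G r.
  apply: addr_ge0 => //; apply: addr_ge0; first by apply: mulr_ge0 => //; exact: ltW.
  apply: mulr_ge0; last exact: energy_ge0.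
  by apply: mulr_ge0 => //; rewrite invr_ge0 ltW.
apply: norm_le_ip => [|w]; first by apply: itg_ge0 => r _; exact: G_ge0.
have -> : ip (y' - z t - UA t s (y - z s)) w = - (itg s t (f w) + itg s t (h w)).
  have ey : ip y' w = ip (UA t s y) w - itg s t (f w) := hy' w.
  have [_ ez] : _ /\ ip (z t) w = ip (UA t s (z s)) w + itg s t (h w) := hz w s0 st tT.
  by rewrite (linearB (UA t s)) !ipBl ey ez; ring.
rewrite normrN -itgD // mulrC -itgZ //.
apply: norm_itg_le; [exact: integrable_onD|exact: integrable_onZ|].
move=> r /andP[sr rt]; have r0 := le_trans s0 sr; have rT := le_trans rt tT.
rewrite /f /h -ipDl mulrC; apply: ip_ub => //.
have n1 : `|UA t r (gain r (P r (eta r)))| <=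
    M * (b * (l + ip (gain r (P r (eta r))) (P r (eta r)) / (l * eps))).
  apply: le_trans (bU _ _ _ r0 rt tT) _; rewrite ler_wpM2l //.
  exact: (norm_feedback_young eps_gt0 (lq_coercive S r) (lq_b S) (lq_normB S r)).
have n2 : `|UA t r (K r (C r (z r)))| <= M * (k * (`|C r (eta r)| + c * (M * `|y - z s|)
     + c * (M * (k * (c * m)) * (t - s)))).
  apply: le_trans (bU _ _ _ r0 rt tT) _; rewrite ler_wpM2l //.
  apply: le_trans (K_le _ _) _; rewrite ler_wpM2l //.
  have -> : z r = eta r - UA r s (y - z s) + (z r - UA r s (z s)).
    by rewrite (linearB (UA r s)) /eta subKr addrC subrK.
  rewrite linearD linearB /=.
  apply: le_trans (ler_normD _ _) _; apply: lerD.
    apply: le_trans (ler_normB _ _) _; rewrite lerD2l.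
    apply: le_trans (lq_normC S _ _) _; rewrite ler_wpM2l //.
    by apply: bU.
  apply: le_trans (lq_normC S _ _) _; rewrite ler_wpM2l //.
  apply: le_trans (observer_drift s0 sr rT) _.
  by rewrite ler_wpM2l ?lerD2r // !mulr_ge0.
have n3 := @young R `|C r (eta r)| l (normr_ge0 _) l_gt0.
apply: le_trans (ler_normD _ _) _.
apply: le_trans (lerD n1 n2) _.
rewrite /G /rest /window_rate /energy -/(eta r).
have sg_ge0 := lq_gain_ge0 S r (P r (eta r)).
have u_ge0 := normr_ge0 (C r (eta r)).
move: (ip _ _) sg_ge0 n3 => sg sg_ge0.
move: `|C r (eta r)| u_ge0 `|y - z s| (t - s) ts_ge0 => u u_ge0 d ts ts_ge0 n3.
have q1 : 0 <= M * (b * (sg / l)) by rewrite !mulr_ge0 ?invr_ge0 // ltW.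
have q2 : 0 <= M * (b / eps * (u ^+ 2 / l)) by rewrite !mulr_ge0 ?invr_ge0 ?sqr_ge0 // ltW.
have q3 : 0 <= M * (k * (sg / l)) by rewrite !mulr_ge0 ?invr_ge0 // ltW.
have q4 : 0 <= M * (b * (u ^+ 2 / l)) by rewrite !mulr_ge0 ?invr_ge0 ?sqr_ge0 // ltW.
have q5 : 0 <= M * (b / eps * l) by rewrite !mulr_ge0 ?invr_ge0 // ltW.
have q6 : 0 <= M * (k * (l + u ^+ 2 / l - u)) by rewrite !mulr_ge0 // subr_ge0.
have := addr_ge0 (addr_ge0 (addr_ge0 q1 q2) (addr_ge0 q3 q4)) (addr_ge0 q5 q6).
move=> hsum; rewrite -subr_ge0; apply: le_trans hsum _.
by rewrite le_eqVlt; apply/orP; left; apply/eqP; field; rewrite !gt_eqF.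
Qed.

(** E is the total cost over the window; l is a weight to be optimized. *)
Lemma gap_bound n x (l : R) : (0 < n)%N -> 0 < l -> z t0 = x ->
  let y := euler UA B Q t0 t1 P n x in
  let E := \sum_(i < n) itg (node t0 t1 n i) (node t0 t1 n i.+1)
              (energy P P (node t0 t1 n i) (y i)) in
  `|y n - z t1| <= window_gap M (t1 - t0) * (l * (t1 - t0) + E / l)
    + M * (M * (k * (c * (M * (k * (c * m)))))) * (t1 - t0) ^+ 2
        * expR (M * (M * (k * (c * M))) * (t1 - t0)) / n%:R.
Proof.
move=> n0 l_gt0 zx /=; set y := euler UA B Q t0 t1 P n x; set E := \sum_(i < n) _.
have [M_ge0 bU] := UM; have c_ge0 := lq_c S; have eps_gt0 := lq_eps S; have b_ge0 := lq_b S.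
have m_ge0 : 0 <= m by apply: le_trans (z_le (r := t0) _); rewrite ?lexx.
have t01' : 0 <= t1 - t0 by rewrite subr_ge0.
pose tau i := node t0 t1 n i.
pose h := mesh t0 t1 n; have h_ge0 : 0 <= h by exact: mesh_ge0.
pose d i := y i - z (tau i).
pose Ei i := itg (tau i) (tau i.+1) (energy P P (tau i) (y i)).
have Ei_ge0 i : 0 <= Ei i by apply: itg_ge0 => r _; exact: energy_ge0.
have hn : h *+ n = t1 - t0.
  by rewrite /h /mesh -[(_ / _) *+ n]mulr_natr divfK // pnatr_eq0 -lt0n.
pose w := window_rate M.
have w_ge0 : 0 <= w by rewrite /w /window_rate mulr_ge0 // !addr_ge0 // divr_ge0 // ltW.
pose a1 := M * (k * (c * M)); have a1_ge0 : 0 <= a1 by rewrite /a1 !mulr_ge0.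
pose a2 := M * (k * (c * (M * (k * (c * m))))); have a2_ge0 : 0 <= a2 by rewrite /a2 !mulr_ge0.
have d0 : d 0 = 0 by rewrite /d /tau node0 zx subrr.
have step i : (i < n)%N -> `|d i.+1 - UA (tau i.+1) (tau i) (d i)| <=
    w * (l * h + Ei i / l) + a2 * h * h + a1 * h * `|d i|.
  move=> ni; have := gap_step (node_ge t01 n i) (node_le t01 n (leqnSn i)) (node_le1 t01 n0 ni)
    l_gt0 (eulerP S UM t01 x hP bP ni).
  rewrite nodeS -/(tau i) -/(tau i.+1) -/(d i) -/(d i.+1) -/h => /le_trans; apply.
  by rewrite le_eqVlt; apply/orP; left; apply/eqP; rewrite /w /a1 /a2 /Ei /d; ring.
pose A := M * (w * (l * (t1 - t0) + E / l) + a2 * h * (t1 - t0)).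
have E_ge0 : 0 <= E by apply: sumr_ge0 => i _; exact: Ei_ge0.
have A_ge0 : 0 <= A.
  apply: mulr_ge0 => //; apply: addr_ge0; last by do 2! apply: mulr_ge0 => //.
  apply: mulr_ge0 => //; apply: addr_ge0; first by apply: mulr_ge0 => //; exact: ltW.
  by apply: mulr_ge0 => //; rewrite invr_ge0 ltW.
have dl_ge0 : 0 <= M * a1 * h by do 2! apply: mulr_ge0 => //.
have := @discrete_gronwall R (fun i => `|d i|) A (M * a1 * h) n dl_ge0 _ n (leqnn n).
have -> : d n = y n - z t1 by rewrite /d /tau nodenn.
move=> /(_ _)/le_trans -> //; last first.
  apply: (@le_trans _ _ (A * expR (M * a1 * (t1 - t0)))).
    rewrite ler_wpM2l //; apply: le_trans (expr_le_expR _ dl_ge0) _.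
    by rewrite ler_expR -mulrnAr hn.
  rewrite /window_gap -/w -/a1 -/a2 /A /h /mesh.
  move: (expR _) => ex.
  have -> : M * (w * (l * (t1 - t0) + E / l) + a2 * ((t1 - t0) / n%:R) * (t1 - t0)) * ex =
    M * w * ex * (l * (t1 - t0) + E / l) + M * a2 * (t1 - t0) ^+ 2 * ex / n%:R by ring.
  rewrite lerD2r ler_wpM2r ?lerDl //; apply: addr_ge0.
    by apply: mulr_ge0 => //; exact: ltW.
  by apply: mulr_ge0 => //; rewrite invr_ge0 ltW.
move=> j jn; apply: le_trans (discrete_duhamel S UM t01 d n0 jn) _.
rewrite d0 normr0 mulr0 add0r.
have -> : A + M * a1 * h * \sum_(i < j) `|d i| =
  M * ((w * (l * (t1 - t0) + E / l) + a2 * h * (t1 - t0)) + \sum_(i < j) a1 * h * `|d i|).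
  by rewrite -mulr_sumr /A; ring.
apply: ler_wpM2l => //.
apply: (@le_trans _ _ (\sum_(i < j) ((w * (l * h + Ei i / l) + a2 * h * h) + a1 * h * `|d i|))).
  by apply: ler_sum => i _; apply: step; exact: leq_trans (ltn_ord i) jn.
rewrite big_split /= lerD2r.
apply: (@le_trans _ _ (\sum_(i < n) (w * (l * h + Ei i / l) + a2 * h * h))).
  rewrite -(subnKC jn) big_split_ord /= lerDl; apply: sumr_ge0 => i _.
  apply: addr_ge0; last by do 2! apply: mulr_ge0 => //.
  apply: mulr_ge0 => //; apply: addr_ge0; first by apply: mulr_ge0 => //; exact: ltW.
  by apply: mulr_ge0 => //; rewrite invr_ge0 ltW.
rewrite big_split /= -mulr_sumr big_split /= -mulr_suml !sumr_const !card_ord.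
by rewrite mulrnAl -[(l * h) *+ n]mulrnAr -[(a2 * h * h) *+ n]mulrnAr hn -mulr_suml.
Qed.

End gap.

End window.

(** * Contraction of a Lyapunov function over one window *)

Section decay.
Context {R : realType} {H U : hilbertType R}.

Context (UA : R -> R -> 'L(H, H)) (B : R -> 'L(U, H))
    (C : R -> 'L(H, H)) (Q : R -> 'L(U, U)) (eps b c : R).
Context (S : lq_system UA B C Q eps b c).
Local Notation riccati := (riccati_on UA B C Q).
Local Notation energy := (energy UA B C Q).
Context (K : R -> 'L(H, H)) (k : R) (k_ge0 : 0 <= k)
  (K_le : forall t x, `|K t x| <= k * `|x|).

(** The factor in front of the cost after [gap_sqr] and
(u + v)^2 <= 2 u^2 + 2 v^2. *)
Definition lyap_weight (M L : R) : R := 16 * window_gap eps b c k M L ^+ 2 * L.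

Lemma window_gap_gt0 M L : 0 <= M -> 0 < window_gap eps b c k M L.
Proof.
move=> M_ge0; rewrite /window_gap ltr_wpDl // mulr_ge0 ?expR_ge0 // mulr_ge0 //.
have eps_gt0 := lq_eps S; have b_ge0 := lq_b S.
by rewrite /window_rate mulr_ge0 // !addr_ge0 // divr_ge0 // ltW.
Qed.

Lemma window_gap_le M L L' : 0 <= M -> L <= L' ->
  window_gap eps b c k M L <= window_gap eps b c k M L'.
Proof.
move=> M_ge0 LL'; rewrite /window_gap lerD2r.
have eps_gt0 := lq_eps S; have b_ge0 := lq_b S; have c_ge0 := lq_c S.
rewrite ler_wpM2l //.
  apply: mulr_ge0 => //.
  by rewrite /window_rate mulr_ge0 // !addr_ge0 // divr_ge0 // ltW.
by rewrite ler_expR ler_wpM2l // !mulr_ge0.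
Qed.

Lemma chain_defect_ge0 (t0 t1 M p1 p2 : R) (x : H) : 0 <= M -> 0 <= p1 -> 0 <= p2 ->
  evolution_bounded UA t0 t1 M ->
  0 <= chain_defect eps b c t0 t1 M p1 p2 x.
Proof.
move=> M_ge0 h1 h2 UM; apply: mulr_ge0; last exact: sqr_ge0.
by apply: mulr_ge0; [apply: addr_ge0; exact: (defect_ge0 S UM) | exact: sqr_ge0].
Qed.

(** The first inequality bounds the form of P2 - P1 at x by its value at y; the
second one combines the stability of the observer with the fact that the gap is paid for by the drop of
(P1 y, y). *)
Lemma window_step (t0 t1 M L m : R) P1 P2 (p1 p2 : R) z x (e : R) :
  evolution_bounded UA t0 t1 M -> t0 < t1 -> t1 - t0 <= L ->
  riccati t0 t1 P1 -> bounded_on t0 t1 p1 P1 ->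
  riccati t0 t1 P2 -> bounded_on t0 t1 p2 P2 ->
  observer UA C K t0 t1 z -> (forall r, t0 <= r <= t1 -> `|z r| <= m) ->
  z t0 = x -> `|z t1| <= 2^-1 * `|x| -> 0 < e ->
  exists y, [/\
    ip (P1 t1 y) y - ip (P2 t1 y) y <= ip (P1 t0 x) x - ip (P2 t0 x) x + e &
    `|y| ^+ 2 + lyap_weight M L * ip (P1 t1 y) y <=
      2^-1 * `|x| ^+ 2 + lyap_weight M L * ip (P1 t0 x) x + e].
Proof.
move=> UM t01 tL h1 b1 h2 b2 hz z_le zx z1 e_gt0.
have t01' := ltW t01; have [M_ge0 _] := UM; have [p1_ge0 _] := b1; have [p2_ge0 _] := b2.
have c_ge0 := lq_c S.
have m_ge0 : 0 <= m by apply: le_trans (z_le t0 _); rewrite ?lexx.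
pose err := M * (M * (k * (c * (M * (k * (c * m)))))) * (t1 - t0) ^+ 2
        * expR (M * (M * (k * (c * M))) * (t1 - t0)).
have ts_ge0 : 0 <= t1 - t0 by rewrite subr_ge0.
have err_ge0 : 0 <= err by rewrite /err !mulr_ge0 ?expR_ge0.
pose c11 := chain_defect eps b c t0 t1 M p1 p1 x.
pose c12 := chain_defect eps b c t0 t1 M p1 p2 x.
have c11_ge0 : 0 <= c11 by apply: chain_defect_ge0.
have c12_ge0 : 0 <= c12 by apply: chain_defect_ge0.
pose w := lyap_weight M L.
have L_ge0 : 0 <= L by apply: le_trans tL; rewrite subr_ge0.
have w_ge0 : 0 <= w by apply: mulr_ge0 => //; apply: mulr_ge0 => //; exact: sqr_ge0.
(* one n makes all the errors of order 1/n small *)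
have [n n0 hn] := @small_harmonic R (c12 + w * c11 + 4 * err ^+ 2) e e_gt0.
have n1 : 1 <= n%:R :> R by rewrite ler1n.
have nV_ge0 : 0 <= n%:R^-1 :> R by rewrite invr_ge0.
pose y := euler UA B Q t0 t1 P1 n x.
pose E := \sum_(i < n) itg (node t0 t1 n i) (node t0 t1 n i.+1)
              (energy P1 P1 (node t0 t1 n i) (y i)).
exists (y n); split.
  apply: le_trans (compare_chain S UM t01' x h1 b1 h2 b2 n0) _; rewrite lerD2l -/c12.
  apply: le_trans hn; rewrite ler_wpM2r // -addrA lerDl.
  by rewrite addr_ge0 // mulr_ge0 ?sqr_ge0.
have E_ge0 : 0 <= E by apply: sumr_ge0 => i _; apply: itg_ge0 => r _; exact: (energy_ge0 S).
have := dissipation_chain S UM t01' x h1 b1 n0; rewrite /= -/y -/E -/c11 => hE.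
have gap : `|y n - z t1| ^+ 2 <= 8 * window_gap eps b c k M (t1 - t0) ^+ 2 * (t1 - t0) * E
    + 2 * (err / n%:R) ^+ 2.
  apply: gap_sqr => //; [exact: window_gap_gt0|by rewrite subr_gt0|exact: mulr_ge0|].
  by move=> l l_gt0; exact: (gap_bound S k_ge0 K_le UM t01' h1 b1 hz z_le n0 l_gt0 zx).
have hw : 16 * window_gap eps b c k M (t1 - t0) ^+ 2 * (t1 - t0) * E <= w * E.
  rewrite ler_wpM2r // /w /lyap_weight; apply: ler_pM => //.
    by apply: mulr_ge0 => //; exact: sqr_ge0.
  rewrite ler_wpM2l //; apply: lerXn2r; rewrite ?nnegrE ?window_gap_le //;
    exact/ltW/window_gap_gt0.
have he : (err / n%:R) ^+ 2 <= err ^+ 2 / n%:R.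
  rewrite expr_div_n ler_wpM2l ?sqr_ge0 // lef_pV2 ?posrE ?exprn_gt0 ?ltr0n //.
  by rewrite expr2 ler_peMl // ltW // ltr0n.
have hy : `|y n| ^+ 2 <= 2 * `|z t1| ^+ 2 + 2 * `|y n - z t1| ^+ 2.
  have : `|y n| ^+ 2 <= (`|z t1| + `|y n - z t1|) ^+ 2.
    apply: lerXn2r; rewrite ?nnegrE ?addr_ge0 //.
    by apply: le_trans (ler_normD _ _); rewrite addrC subrK.
  move/le_trans; apply; have := sqr_ge0 (`|z t1| - `|y n - z t1|).
  move: `|z t1| `|y n - z t1| => a d.
  have -> : (a + d) ^+ 2 = 2 * a ^+ 2 + 2 * d ^+ 2 - (a - d) ^+ 2 by ring.
  by move: (a ^+ 2) (d ^+ 2) ((a - d) ^+ 2) => *; lra.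
have hz2 : 2 * `|z t1| ^+ 2 <= 2^-1 * `|x| ^+ 2.
  have : `|z t1| ^+ 2 <= (2^-1 * `|x|) ^+ 2 by apply: lerXn2r; rewrite ?nnegrE ?mulr_ge0.
  rewrite exprMn (_ : 2^-1 ^+ 2 = 4^-1 :> R); last by field.
  by move: (`|z t1| ^+ 2) (`|x| ^+ 2) => *; lra.
have wE : w * E <= w * (ip (P1 t0 x) x - ip (P1 t1 (y n)) (y n) + c11 / n%:R).
  have aux (u v x1 x2 : R) : v + u <= x1 + x2 -> u <= x1 - v + x2 by move=> ?; lra.
  by rewrite ler_wpM2l // aux.
have c12n : 0 <= c12 / n%:R by rewrite mulr_ge0.
rewrite -/w.
have hn' : c12 / n%:R + w * (c11 / n%:R) + 4 * (err ^+ 2 / n%:R) <= e.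
  by apply: le_trans hn; rewrite le_eqVlt; apply/orP; left; apply/eqP; ring.
have gap' : 2 * `|y n - z t1| ^+ 2 <= w * E + 4 * (err ^+ 2 / n%:R).
  move: gap hw he; move: (err ^+ 2 / n%:R) ((err / n%:R) ^+ 2) (w * E).
  move: (`|y n - z t1| ^+ 2) (window_gap _ _ _ _ _ _ ^+ 2) => v G u1 u2 u3.
  have -> : 8 * G * (t1 - t0) * E = 8 * (G * (t1 - t0) * E) by ring.
  have -> : 16 * G * (t1 - t0) * E = 16 * (G * (t1 - t0) * E) by ring.
  by move: (G * (t1 - t0) * E) => *; lra.
rewrite mulrDr mulrBr in wE.
move: (`|y n| ^+ 2) (`|z t1| ^+ 2) (`|y n - z t1| ^+ 2) (`|x| ^+ 2) (w * ip _ _) (w * ip _ _)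
  (w * E) (w * (c11 / n%:R)) (err ^+ 2 / n%:R) (c12 / n%:R) hy hz2 wE c12n hn' gap'.
by move=> *; lra.
Qed.

End decay.

(** * Uniform bounds by periodicity *)

Section periodic_bounds.
Context {R : realType}.

Lemma op_periodic_mulrn (V W : normedModType R) (theta : R) (F : R -> 'L(V, W)) n t x :
  op_periodic theta F -> F (t + theta *+ n) x = F t x.
Proof.
move=> Fp; elim: n => [|n IH]; first by rewrite mulr0n addr0.
by rewrite mulrSr addrA Fp.
Qed.

Lemma reduce_period (theta t : R) : 0 < theta -> 0 <= t ->
  exists n (r : R), [/\ 0 <= r, r <= theta & t = r + theta *+ n].
Proof.
move=> th t_ge0; pose n := Num.truncn (t / theta).
have := truncn_itv (divr_ge0 t_ge0 (ltW th)); rewrite -/n => /andP[h1 h2].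
exists n, (t - theta *+ n); split; last by rewrite subrK.
  by rewrite subr_ge0 -mulr_natl -ler_pdivlMr.
by rewrite lerBlDr -mulrS -mulr_natl -ler_pdivrMr // ltW.
Qed.

Lemma periodic_bounded (V : hilbertType R) (W : normedModType R) (theta : R)
    (F : R -> 'L(V, W)) : 0 < theta -> op_periodic theta F ->
  (forall x, {within `[0, theta], continuous (fun t => F t x)}) ->
  exists2 c : R, 0 <= c & forall t x, `|F t x| <= c * `|x|.
Proof.
move=> th Fp cF; have [c c_ge0 hc] := strong_bounded (@segment_compact R 0 theta) cF.
exists c => // t x.
have [n [m e]] : exists n m, 0 <= t + theta *+ n /\ m = t + theta *+ n.
  exists (Num.truncn (`|t| / theta)).+1, (t + theta *+ (Num.truncn (`|t| / theta)).+1); split => //.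
  have := truncnS_gt (`|t| / theta).
  rewrite ltr_pdivrMr // mulr_natl => /ltW h; rewrite -lerBlDl sub0r.
  by apply: le_trans h; rewrite -normrN ler_norm.
have [n' [r [r0 rth er]]] := reduce_period th e.1.
have rin : `[0, theta]%classic r by rewrite /= in_itv /= r0.
by have := hc r x rin; rewrite -(op_periodic_mulrn n' r x Fp) -er op_periodic_mulrn.
Qed.

Lemma evolution_uniform_bound (H : hilbertType R) (UA : R -> R -> 'L(H, H)) (theta L : R) :
  0 < theta -> 0 <= L -> evolution_periodic theta UA ->
  (forall x, {within [set p : R * R | p.2 <= p.1], continuous (fun p => UA p.1 p.2 x)}) ->
  exists2 M : R, 0 <= M & forall t0 : R, 0 <= t0 -> evolution_bounded UA t0 (t0 + L) M.
Proof.
move=> th L_ge0 Up cU.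
pose D : set (R * R) := (`[0, theta + L] `*` `[0, theta])%classic.
pose E := D `&` [set p : R * R | p.2 <= p.1].
have cE : compact E.
  apply: compact_closedI; first by apply: compact_setX; exact: segment_compact.
  have -> : [set p : R * R | p.2 <= p.1] = (fun p : R * R => p.1 - p.2) @^-1` [set y | 0 <= y].
    by apply/seteqP; split => p /=; rewrite subr_ge0.
  apply: preimage_closed; last exact: closed_ge.
  by move=> p _; apply: cvgB; [exact: cvg_fst | exact: cvg_snd].
have [M M_ge0 hM] : exists2 M : R, 0 <= M & forall p x, E p -> `|UA p.1 p.2 x| <= M * `|x|.
  apply: (strong_bounded cE) => x; apply: (continuous_subspaceW _ (cU x)).
  by move=> p [].
exists M => // t0 t0_ge0; split => // s t x s0 st tT.
have [n [r [r0 rth es]]] := reduce_period th (le_trans t0_ge0 s0).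
have rt : r <= t - theta *+ n by rewrite lerBrDr -es.
have : forall m, UA (t - theta *+ n + theta *+ m) (r + theta *+ m) x = UA (t - theta *+ n) r x.
  elim=> [|m IH]; first by rewrite mulr0n !addr0.
  by rewrite mulrSr !addrA Up // lerD2r.
move=> /(_ n); rewrite subrK -es => ->.
apply: (hM (_, _)); split => //=; split; rewrite /= in_itv /=; last by rewrite r0.
rewrite (le_trans r0 rt) /= lerBlDr; apply: le_trans tT _.
rewrite addrAC lerD2r; apply: le_trans s0 _.
by rewrite es lerD2r.
Qed.

End periodic_bounds.

(** * Iteration over windows *)

Section iteration.
Context {R : realType} {H U : hilbertType R}.
Context (UA : R -> R -> 'L(H, H)) (B : R -> 'L(U, H))
    (C : R -> 'L(H, H)) (Q : R -> 'L(U, U)) (eps b c : R).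
Context (S : lq_system UA B C Q eps b c).
Local Notation riccati := (riccati_on UA B C Q).
Context (K : R -> 'L(H, H)) (k : R) (k_ge0 : 0 <= k)
  (K_le : forall t x, `|K t x| <= k * `|x|).

(** The integral equation for V from t0 to t is split at s, and U_A(t,s) is
factored out of the part before s. *)
Lemma perturbed_observer (V : R -> R -> 'L(H, H)) (t0 t1 : R) x :
  perturbed_evolution UA (fun t x => K t (C t x)) V -> observer UA C K t0 t1 (fun r => V r t0 x).
Proof.
move=> [_ hV] s t w s0 st _.
have [I hI eI] := hV t t0 x (le_trans s0 st); have [J hJ eJ] := hV s t0 x s0.
pose f r := K r (C r (V r t0 x)).
have [iw ew] : integrable_on t0 t (fun r => ip (UA t r (f r)) w) /\
   ip I w = itg t0 t (fun r => ip (UA t r (f r)) w) := hI w.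
have [iw' ew'] : integrable_on t0 s (fun r => ip (UA s r (f r)) (adjoint (UA t s) w)) /\
   ip J (adjoint (UA t s) w) = itg t0 s (fun r => ip (UA s r (f r)) (adjoint (UA t s) w)) := hJ _.
split; first exact: integrable_onS iw.
rewrite eI eJ ipDl ew (itg_chasles s0 st iw) addrA; congr (_ + _).
rewrite linearD ipDl /= (lq_comp S) //; congr (_ + _).
rewrite adjointP ew'; apply: eq_itg => r /andP[_ rs].
by rewrite -adjointP (lq_comp S).
Qed.

Context (L M p : R) (L_gt0 : 0 < L) (p_ge0 : 0 <= p)
  (UM : forall t0 : R, 0 <= t0 -> evolution_bounded UA t0 (t0 + L) M).
Context (z : R -> H -> R -> H) (m0 : R) (L0 : R)
  (hz : forall (t0 t1 : R) x, 0 <= t0 -> observer UA C K t0 t1 (z t0 x))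
  (z_id : forall t0 x, z t0 x t0 = x)
  (z_le : forall (t0 : R) x (r : R), 0 <= t0 -> t0 <= r -> `|z t0 x r| <= m0 * `|x|)
  (z_half : forall (t0 : R) x (r : R), 0 <= t0 -> t0 + L0 <= r -> `|z t0 x r| <= 2^-1 * `|x|).

Local Notation w := (lyap_weight eps b c k M L).

(** The relative loss of |y|^2 + w (P1 y, y) over one window: half of |x|^2 is
lost, and the function is at most (1 + w p) |x|^2. *)
Definition lyap_rate : R := (2 * (1 + w * p))^-1.

Context (T : R) (P1 P2 : R -> 'L(H, H)) (p1 p2 : R)
  (h1 : riccati 0 T P1) (b1 : bounded_on 0 T p1 P1)
  (h2 : riccati 0 T P2) (b2 : bounded_on 0 T p2 P2)
  (P1_le : forall (t : R) x, 0 <= t -> t <= T -> ip (P1 t x) x <= p * `|x| ^+ 2).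

Lemma bounded_on_sub (s0 s1 q : R) (P : R -> 'L(H, H)) : 0 <= s0 -> s1 <= T -> bounded_on 0 T q P ->
  bounded_on s0 s1 q P.
Proof.
move=> h0 hT [q_ge0 hq]; split => // r x /andP[a1 a2]; apply: hq.
by rewrite (le_trans h0) // (le_trans a2).
Qed.

Lemma weight_ge0 : 0 <= w.
Proof. by apply: mulr_ge0; [apply: mulr_ge0 => //; exact: sqr_ge0 | exact: ltW]. Qed.

Lemma lyap_rate_itv : 0 < lyap_rate <= 2^-1.
Proof.
have w_ge0 := weight_ge0.
have h : 1 <= 1 + w * p by rewrite lerDl mulr_ge0.
have h0 : 0 < 1 + w * p by apply: lt_le_trans h.
rewrite /lyap_rate invr_gt0 mulr_gt0 //= lef_pV2 ?posrE ?mulr_gt0 //.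
by rewrite ler_peMr.
Qed.

Lemma lyap_contract (t : R) x : 0 <= t -> t <= T ->
  2^-1 * `|x| ^+ 2 + w * ip (P1 t x) x <=
  (1 - lyap_rate) * (`|x| ^+ 2 + w * ip (P1 t x) x).
Proof.
move=> t0 tT; have w_ge0 := weight_ge0; have /andP[c_gt0 _] := lyap_rate_itv.
have h : w * ip (P1 t x) x <= w * (p * `|x| ^+ 2) by rewrite ler_wpM2l // P1_le.
have e : lyap_rate * (`|x| ^+ 2 + w * (p * `|x| ^+ 2)) = 2^-1 * `|x| ^+ 2.
  rewrite /lyap_rate; field; apply: lt0r_neq0.
  by rewrite ltr_wpDr // mulr_ge0.
have : lyap_rate * (`|x| ^+ 2 + w * ip (P1 t x) x) <= 2^-1 * `|x| ^+ 2.
  by rewrite -e ler_wpM2l ?lerD2l // ltW.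
have aux (q u v : R) : q <= 2^-1 * u -> 2^-1 * u + v <= u + v - q by move=> ?; lra.
by rewrite mulrBl mul1r; exact: aux.
Qed.

Lemma iterate_windows (l : R) n (t : R) x (e : R) : 0 < l -> L0 <= l -> l <= L -> 0 <= t ->
  t + l *+ n = T -> 0 < e ->
  exists y, ip (P2 t x) x - ip (P1 t x) x <= ip (P2 T y) y - ip (P1 T y) y + e /\
   `|y| ^+ 2 + w * ip (P1 T y) y <=
     (1 - lyap_rate) ^+ n * (`|x| ^+ 2 + w * ip (P1 t x) x) + e.
Proof.
move=> l_gt0 L0l lL; have /andP[q_gt0 q_le] := lyap_rate_itv.
have q_ge0 : 0 <= 1 - lyap_rate by move: lyap_rate q_gt0 q_le => *; lra.
have q_le1 : 1 - lyap_rate <= 1 by move: lyap_rate q_gt0 q_le => *; lra.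
elim: n t x e => [|n IH] t x e t_ge0 tT e_gt0.
  exists x; rewrite -tT mulr0n addr0 expr0 mul1r.
  by split; rewrite lerDl ltW.
have e2_gt0 : 0 < e / 2 by rewrite divr_gt0.
have tlT : t + l <= T by rewrite -tT mulrS addrA lerDl mulrn_wge0 // ltW.
have tl : t < t + l by rewrite ltrDl.
have tT' : t <= T := le_trans (ltW tl) tlT.
have UMt : evolution_bounded UA t (t + l) M.
  have [M_ge0 hM] := UM t_ge0; split => // r s v r0 rs sT; apply: hM => //.
  by apply: le_trans sT _; rewrite lerD2l.
have dl : t + l - t <= L by rewrite addrC addKr.
have [y1 [y1a y1b]] := window_step S k_ge0 K_le UMt tl dl
  (riccati_sub t_ge0 tlT h1) (bounded_on_sub t_ge0 tlT b1)
  (riccati_sub t_ge0 tlT h2) (bounded_on_sub t_ge0 tlT b2)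
  (@hz t (t + l) x t_ge0) (fun r hr => @z_le t x r t_ge0 (proj1 (andP hr))) (@z_id t x)
  (@z_half t x (t + l) t_ge0 (ltac:(by rewrite lerD2l) : t + L0 <= t + l)) e2_gt0.
have [y [ya yb]] := IH (t + l) y1 (e / 2) (le_trans t_ge0 (ltW tl))
  (ltac:(by rewrite -addrA -mulrS) : t + l + l *+ n = T) e2_gt0.
exists y; split.
  by move: (ip _ _) (ip _ _) (ip _ _) (ip _ _) (ip _ _) (ip _ _) y1a ya => *; lra.
apply: le_trans yb _.
have := lyap_contract x t_ge0 tT'; move: y1b.
set A := `|x| ^+ 2 + _; set A1 := `|y1| ^+ 2 + _; set X := _ + w * _ => hA1 hX.
have {}hA1 : A1 <= (1 - lyap_rate) * A + e / 2 by apply: le_trans hA1 _; rewrite lerD2r.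
have qn_ge0 : 0 <= (1 - lyap_rate) ^+ n by rewrite exprn_ge0.
have qn_le1 : (1 - lyap_rate) ^+ n <= 1 by rewrite exprn_ile1.
apply: (@le_trans _ _ ((1 - lyap_rate) ^+ n * ((1 - lyap_rate) * A + e / 2) + e / 2)).
  by rewrite lerD2r ler_wpM2l.
rewrite mulrDr mulrA -exprSr -addrA lerD2l [leRHS](splitr e) lerD2r.
by rewrite ler_piMl // ltW.
Qed.

(** [0, T] is cut, from t on, into equal windows of length between L0 and 2 L0. The
factor expR 1 covers the case where T - t is shorter than one window. *)
Lemma difference_decay (t : R) x : L0 + L0 <= L -> 0 < L0 -> 0 <= t -> t <= T ->
  (forall y, P1 T y = 0) -> (forall y, ip (P2 T y) y <= p * `|y| ^+ 2) ->
  ip (P2 t x) x - ip (P1 t x) x <= p * `|x| ^+ 2 ->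
  ip (P2 t x) x - ip (P1 t x) x <=
    p * (1 + w * p) * expR 1 * expR (- (lyap_rate / L) * (T - t)) * `|x| ^+ 2.
Proof.
move=> L0L L0_gt0 t_ge0 tT P1T P2T Dx.
have /andP[q_gt0 q_le] := lyap_rate_itv; have w_ge0 := weight_ge0.
have x2 : 0 <= `|x| ^+ 2 by exact: sqr_ge0.
have wp_ge1 : 1 <= 1 + w * p by rewrite lerDl mulr_ge0.
have Tt : 0 <= T - t by rewrite subr_ge0.
case: (ltP (T - t) L0) => hT.
  apply: le_trans Dx _; rewrite ler_wpM2r //.
  have ex1 : 1 <= expR 1 * expR (- (lyap_rate / L) * (T - t)).
    rewrite -expRD -[leLHS]expR0 ler_expR mulNr subr_ge0 mulrAC ler_pdivrMr // mul1r.
    apply: (@le_trans _ _ (1 * L0)); last by rewrite mul1r; apply: le_trans L0L; rewrite lerDl ltW.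
    apply: ler_pM => //; [exact: ltW | by apply: le_trans q_le _; lra | exact: ltW].
  rewrite -mulrA -mulrA ler_peMr //; exact: mulr_ege1.
pose n := Num.truncn ((T - t) / L0).
have n_itv := truncn_itv (divr_ge0 Tt (ltW L0_gt0)).
have /andP[n1 n2] : n%:R <= (T - t) / L0 < n.+1%:R := n_itv.
have n_gt0 : (0 < n)%N.
  have : 1 < n.+1%:R :> R by apply: le_lt_trans n2; rewrite ler_pdivlMr ?mul1r.
  by rewrite ltr1n ltnS.
have nR : 0 < n%:R :> R by rewrite ltr0n.
pose l := (T - t) / n%:R.
have ln : t + l *+ n = T by rewrite -[l *+ n]mulr_natr divfK ?gt_eqF // addrC subrK.
have L0l : L0 <= l by rewrite /l ler_pdivlMr // mulrC -ler_pdivlMr.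
have l_gt0 : 0 < l := lt_le_trans L0_gt0 L0l.
have lL : l <= L.
  rewrite /l ler_pdivrMr //; move: n2; rewrite ltr_pdivrMr // => /ltW/le_trans; apply.
  apply: (@le_trans _ _ ((L0 + L0) * n%:R)); last by rewrite ler_wpM2r // ltW.
  rewrite mulrDl mulrSr mulrDl mul1r mulrC lerD2l.
  by rewrite ler_peMr ?ler1n // ltW.
apply/ler_addgt0Pr => e e_gt0.
have e'_gt0 : 0 < e / (p + 1) by rewrite divr_gt0 // ltr_wpDl.
have [y [ya yb]] := iterate_windows x l_gt0 L0l lL t_ge0 ln e'_gt0.
apply: le_trans ya _; rewrite P1T ip0l subr0.
rewrite P1T ip0l mulr0 addr0 in yb.
have hE : `|x| ^+ 2 + w * ip (P1 t x) x <= (1 + w * p) * `|x| ^+ 2.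
  by rewrite mulrDl mul1r lerD2l -mulrA ler_wpM2l // P1_le.
have q_ge0 : 0 <= 1 - lyap_rate by move: lyap_rate q_gt0 q_le => *; lra.
have hq : (1 - lyap_rate) ^+ n <= expR (- (lyap_rate / L) * (T - t)).
  apply: (@le_trans _ _ (expR (- lyap_rate) ^+ n)).
    by apply: lerXn2r; rewrite ?nnegrE ?expR_ge0 // expR_ge1Dx.
  rewrite -expRM_natl ler_expR !mulNr mulrN lerN2 mulrAC ler_pdivrMr //.
  rewrite (_ : n%:R * lyap_rate * L = lyap_rate * (L * n%:R)); last by ring.
  apply: ler_wpM2l; first exact: ltW.
  by rewrite -[leLHS](divfK (lt0r_neq0 nR)) ler_wpM2r // ltW.
have e1 : 1 <= expR 1 :> R by rewrite -[leLHS]expR0 ler_expR.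
set ex := expR (- _ * _) in hq *.
have ex_ge0 : 0 <= ex by exact: expR_ge0.
apply: (@le_trans _ _ (p * (ex * ((1 + w * p) * `|x| ^+ 2) + e / (p + 1)) + e / (p + 1))).
  rewrite lerD2r; apply: le_trans (P2T y) _; rewrite ler_wpM2l //.
  apply: le_trans yb _; rewrite lerD2r.
  apply: (@le_trans _ _ ((1 - lyap_rate) ^+ n * ((1 + w * p) * `|x| ^+ 2))).
    by rewrite ler_wpM2l // exprn_ge0.
  by rewrite ler_wpM2r // mulr_ge0 // (le_trans _ wp_ge1).
have -> : p * (ex * ((1 + w * p) * `|x| ^+ 2) + e / (p + 1)) + e / (p + 1) =
   p * (1 + w * p) * ex * `|x| ^+ 2 + e by field; rewrite gt_eqF // ltr_wpDl.
rewrite lerD2r ler_wpM2r // ler_wpM2r //.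
by rewrite ler_peMr // mulr_ge0 // (le_trans _ wp_ge1).
Qed.

End iteration.

(** * The exponential estimate *)

(** Cauchy-Schwarz for the form of D, applied to x and D x. *)
Lemma norm_le_quadratic (R : realType) (H : hilbertType R) (D : {linear H -> H}) (v : R) x :
  0 <= v -> nonneg_selfadjoint D -> (forall y, ip (D y) y <= v * `|y| ^+ 2) ->
  `|D x| <= v * `|x|.
Proof.
move=> v_ge0 Dn Dv; have [->|Dx_neq0] := eqVneq (D x) 0; first by rewrite normr0 mulr_ge0.
have nx : 0 < `|D x| by rewrite normr_gt0.
have := psd_cauchy_schwarz x (D x) Dn; rewrite ipp => h.
rewrite -(@ler_pXn2r _ 2) ?nnegrE ?mulr_ge0 //.
rewrite -(@ler_pM2r _ (`|D x| ^+ 2)) ?exprn_gt0 //.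
have -> : `|D x| ^+ 2 * `|D x| ^+ 2 = (`|D x| ^+ 2) ^+ 2 by rewrite -expr2.
apply: le_trans h _.
have -> : (v * `|x|) ^+ 2 * `|D x| ^+ 2 = (v * `|x| ^+ 2) * (v * `|D x| ^+ 2) by ring.
by apply: ler_pM; rewrite ?nsa_ge0.
Qed.

Lemma perturbed_id (R : realType) (H : hilbertType R) (UA : R -> R -> 'L(H, H))
    (D : R -> H -> H) (V : R -> R -> 'L(H, H)) s x :
  perturbed_evolution UA D V -> V s s x = UA s s x.
Proof.
move=> [_ /(_ s s x (lexx _)) [I hI ->]].
suff -> : I = 0 by rewrite addr0.
apply: ip_ext => y; rewrite ip0l; have [_ e] := hI y; apply: (etrans e).
by rewrite set_itv1 Rintegral_set1.
Qed.

Theorem proposition3p1 (R : realType) (H U : hilbertType R) (theta : R)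
    (A : R -> partial_operator H) (UA : R -> R -> 'L(H, H))
    (B : R -> 'L(U, H)) (C : R -> 'L(H, H)) (Q : R -> 'L(U, U)) (eps : R)
    (theta_gt0 : 0 < theta)
    (A_linear : forall t, linear_operator (A t))
    (A_periodic : unbounded_periodic theta A)
    (A_generates : evolution_system setT A UA)
    (UA_periodic : evolution_periodic theta UA)
    (A_yosida : yosida_convergent theta A UA)
    (B_continuous : strongly_continuous B)
    (B_periodic : op_periodic theta B)
    (C_continuous : strongly_continuous C)
    (C_nonneg : forall t, nonneg_selfadjoint (C t))
    (C_periodic : op_periodic theta C)
    (Q_continuous : strongly_continuous Q)
    (Q_nonneg : forall t, nonneg_selfadjoint (Q t))
    (Q_periodic : op_periodic theta Q)
    (eps_gt0 : 0 < eps)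
    (Q_coercive : forall t u, eps * dotp u u <= dotp (Q t u) u)
    (AB_stabilizable : stabilizable theta UA B)
    (AC_detectable : detectable theta UA C)
    (Ptheta : R -> 'L(H, H))
    (Ptheta_periodic : op_periodic theta Ptheta)
    (Ptheta_mild : mild_solution UA B C Q theta Ptheta) :
  exists M mu : R, [/\ 0 < M, 0 < mu &
    forall (T : R) (PT : R -> 'L(H, H)), 0 < T ->
      mild_solution UA B C Q T PT -> (forall x, PT T x = 0) ->
      forall t, 0 <= t <= T ->
        opnorm (Ptheta t \- PT t) <= M * expR (- mu * (T - t))].
Proof.
have [K [K_per K_cont [V hV [Mv [rho [Mv_gt0 rho_gt0 V_le]]]]]] := AC_detectable.
have [Pn cP _] := Ptheta_mild.
have strong_within (V1 V2 : normedModType R) (F : R -> 'L(V1, V2)) :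
    strongly_continuous F -> forall x, {within `[0, theta], continuous (fun t => F t x)}.
  by move=> cF x; apply: continuous_subspaceT; exact: cF.
have [b b_ge0 b_le] := periodic_bounded theta_gt0 B_periodic (strong_within _ _ _ B_continuous).
have [c c_ge0 c_le] := periodic_bounded theta_gt0 C_periodic (strong_within _ _ _ C_continuous).
have [k k_ge0 k_le] := periodic_bounded theta_gt0 K_per (strong_within _ _ _ K_cont).
have [p p_ge0 p_le] := periodic_bounded theta_gt0 Ptheta_periodic cP.
have cU x : {within [set p : R * R | p.2 <= p.1], continuous (fun p => UA p.1 p.2 x)}.
  by apply: (continuous_subspaceW _ (@evolution_continuous _ _ _ _ _ A_generates x)).
have S : lq_system UA B C Q eps b c.
  split=> //.
  - by move=> s x; exact: (evolution_id A_generates).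
  - by move=> s r t x; exact: (evolution_comp A_generates).
  - by move=> t; split; [exact: Q_nonneg | exact: Q_coercive].
(* expR (rho * L0) >= 1 + 2 * Mv, so z is halved after a time L0 *)
pose L0 : R := 2 * Mv / rho; pose L : R := L0 + L0.
have L0_gt0 : 0 < L0 by rewrite divr_gt0 // mulr_gt0.
have L_gt0 : 0 < L by rewrite addr_gt0.
have [M M_ge0 UM] := evolution_uniform_bound theta_gt0 (ltW L_gt0) UA_periodic cU.
have VE (t0 r : R) x : 0 <= t0 -> t0 <= r ->
    `|V r t0 x| <= Mv * expR (- rho * (r - t0)) * `|x|.
  move=> t0_ge0 t0r; apply: le_trans (le_opnorm _ _) _.
  by rewrite ler_wpM2r // V_le.
have z_le (t0 : R) x (r : R) : 0 <= t0 -> t0 <= r -> `|V r t0 x| <= Mv * `|x|.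
  move=> t0_ge0 t0r; apply: le_trans (VE _ _ _ t0_ge0 t0r) _.
  rewrite ler_wpM2r // ler_piMr ?(ltW Mv_gt0) // -[leRHS]expR0 ler_expR.
  by rewrite mulNr oppr_le0 mulr_ge0 ?subr_ge0 // ltW.
have z_half (t0 : R) x (r : R) : 0 <= t0 -> t0 + L0 <= r -> `|V r t0 x| <= 2^-1 * `|x|.
  move=> t0_ge0 t0r; have t0r' : t0 <= r by apply: le_trans t0r; rewrite lerDl ltW.
  apply: le_trans (VE _ _ _ t0_ge0 t0r') _; rewrite ler_wpM2r //.
  apply: (@le_trans _ _ (Mv * expR (- (2 * Mv)))).
    rewrite ler_wpM2l ?(ltW Mv_gt0) // ler_expR mulNr lerN2 [leRHS]mulrC -ler_pdivrMr //.
    by rewrite lerBrDl.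
  rewrite expRN ler_pdivrMr ?expR_gt0 //.
  have := @expR_ge1Dx R (2 * Mv); move: (expR _) => ex ?; lra.
pose w := lyap_weight eps b c k M L.
have w_ge0 : 0 <= w := weight_ge0 eps b c k M L_gt0.
have /andP[q_gt0 _] := lyap_rate_itv eps b c k M L_gt0 p_ge0.
pose q := lyap_rate eps b c k L M p.
exists (p * (1 + w * p) * expR 1 + 1), (q / L).
have N_ge0 : 0 <= p * (1 + w * p) * expR 1.
  apply: mulr_ge0; last exact: expR_ge0.
  by apply: mulr_ge0 => //; apply: addr_ge0 => //; exact: mulr_ge0.
split; [by rewrite ltr_wpDl | by rewrite divr_gt0 |].
move=> T PT T_gt0 PT_mild PT_T t /andP[t_ge0 tT].
have h1 : riccati_on UA B C Q 0 T PT := mild_riccati S PT_mild.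
have [n1 c1 _] := PT_mild.
have [p1 p1_ge0 p1_le] := strong_bounded (@segment_compact R 0 T) c1.
have b1 : bounded_on 0 T p1 PT by split => // r x h; apply: p1_le; rewrite /= in_itv.
have h2 : riccati_on UA B C Q 0 T Ptheta.
  have := riccati_periodic S theta_gt0 UA_periodic B_periodic C_periodic Q_periodic
    (Num.truncn (T / theta)) Ptheta_periodic (mild_riccati S Ptheta_mild).
  apply: riccati_sub => //.
  by rewrite -mulr_natl -ler_pdivrMr // ltW // truncnS_gt.
have [n2 _ _] := h2.
have b2 : bounded_on 0 T p Ptheta by split.
have quad s x : ip (Ptheta s x) x <= p * `|x| ^+ 2.
  by apply: le_trans (ler_norm _) _; rewrite expr2 mulrA; exact: ip_ub.
have [MT MT_ge0 UMT] := evolution_uniform_bound theta_gt0 (ltW T_gt0) UA_periodic cU.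
have order s x : 0 <= s -> s <= T -> ip (PT s x) x <= ip (Ptheta s x) x.
  move=> s_ge0 sT.
  have UMs : evolution_bounded UA s T MT.
    have [_ hM] := UMT s s_ge0; split => // s' t' y h h' h''; apply: hM => //.
    by apply: le_trans h'' _; rewrite lerDr.
  apply: (riccati_order S x UMs sT (riccati_sub s_ge0 (lexx T) h2) (bounded_on_sub s_ge0 (lexx T) b2)
    (riccati_sub s_ge0 (lexx T) h1) (bounded_on_sub s_ge0 (lexx T) b1)) => y.
  by rewrite PT_T ip0l; apply: nsa_ge0; apply: n2; rewrite lexx ltW.
have P1_le (s : R) x : 0 <= s -> s <= T -> ip (PT s x) x <= p * `|x| ^+ 2.
  by move=> s_ge0 sT; apply: le_trans (order s x s_ge0 sT) (quad s x).
have tin : 0 <= t <= T by rewrite t_ge0.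
have nt1 := n1 t tin; have nt2 := n2 t tin.
have decay y : ip (Ptheta t y) y - ip (PT t y) y <=
    p * (1 + w * p) * expR 1 * expR (- (q / L) * (T - t)) * `|y| ^+ 2.
  apply: (@difference_decay _ _ _ UA B C Q eps b c S K k k_ge0 k_le L M p L_gt0 p_ge0 UM
    (fun t0 x r => V r t0 x) Mv L0 _ _ z_le z_half T PT Ptheta p1 p h1 b1 h2 b2 P1_le) => //.
  - by move=> t0 t1 x _; exact: (perturbed_observer S x hV).
  - by move=> t0 x; rewrite (perturbed_id t0 x hV) (lq_id S).
  - by apply: le_trans (quad t y); rewrite lerBlDr lerDl nsa_ge0.
have ex_ge0 : 0 <= expR (- (q / L) * (T - t)) by exact: expR_ge0.
apply: opnormP; first by rewrite mulr_ge0 // addr_ge0.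
move=> x; apply: (@le_trans _ _ (p * (1 + w * p) * expR 1 * expR (- (q / L) * (T - t)) * `|x|)).
  apply: (@norm_le_quadratic _ _ (Ptheta t \- PT t)) => [|| y].
  - exact: mulr_ge0.
  - split => [y z|y]; rewrite -!/(ip _ _) /= ?ipBl ?ipBr.
      by rewrite (nsa_sym y z nt1) (nsa_sym y z nt2).
    by rewrite subr_ge0 order.
  - by rewrite /= ipBl decay.
by rewrite ler_wpM2r // ler_wpM2r // lerDl.
Qed.
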